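(* Let $s\in I(\Phi)$ belong to the Weyl group $W(\Phi)$. Then there is $\sigma\in\mathrm{Inv}^\tau_s(\mathfrak g_{\mathbb R},\mathfrak h_{\mathbb R})$ such that the real Lie algebra $\mathfrak g_\sigma$ is isomorphic to the split real form $\mathfrak g_{\mathbb R}$.
   Context: $\mathfrak g$ is a complex semisimple Lie algebra, $\mathfrak h$ a Cartan subalgebra, $\Phi=\Phi(\mathfrak g,\mathfrak h)$, $\mathfrak h_{\mathbb R}=\{H\in\mathfrak h:\alpha(H)\in\mathbb R\ \forall\alpha\}$; the Killing form gives an inner product on $\mathfrak h_{\mathbb R}$ and on $V=\mathfrak h_{\mathbb R}^*$, in which $\Phi$ is a root system; $W(\Phi)$ is its Weyl group and $I(\Phi)$ the set of orthogonal involutions of $V$ preserving $\Phi$. Fix a Chevalley system $\{(X_\alpha,H_\alpha)\}$: $X_\alpha\in\mathfrak g^\alpha$, $H_\alpha\in\mathfrak h_{\mathbb R}$, $\alpha(H_\beta)\in\mathbb Z$, $[X_\alpha,X_{-\alpha}]=-H_\alpha$, $[H_\alpha,X_{\pm\alpha}]=\pm2X_{\pm\alpha}$, with $\mathfrak g_{\mathbb R}=\mathfrak h_{\mathbb R}\oplus\bigoplus_\alpha\mathbb RX_\alpha$ a split real form and $\tau$ ($\tau|_{\mathfrak h_{\mathbb R}}=-\mathrm{id}$, $\tau X_\alpha=X_{-\alpha}$) an involutive automorphism of $\mathfrak g_{\mathbb R}$; $\mathfrak g_u=\{X\in\mathfrak g_{\mathbb R}:\tau X=X\}\oplus i\{X\in\mathfrak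 g_{\mathbb R}:\tau X=-X\}$. Automorphisms of $\mathfrak g_{\mathbb R}$ are extended anti-$\mathbb C$-linearly to $\mathfrak g$. $\mathrm{Inv}^\tau(\mathfrak g_{\mathbb R},\mathfrak h_{\mathbb R})$ is the set of involutive automorphisms $\sigma$ of $\mathfrak g_{\mathbb R}$ with $\sigma(\mathfrak h_{\mathbb R})=\mathfrak h_{\mathbb R}$ and $\sigma(\mathfrak g_u)=\mathfrak g_u$; for such $\sigma$, $\rho(\sigma)\in I(\Phi)$ is $\alpha\mapsto\alpha\circ\sigma^{-1}|_{\mathfrak h_{\mathbb R}}$, and $\mathrm{Inv}^\tau_s(\mathfrak g_{\mathbb R},\mathfrak h_{\mathbb R})=\{\sigma:\rho(\sigma)=s\}$. For such $\sigma$, $\mathfrak g_\sigma=\{X\in\mathfrak g_{\mathbb R}:\sigma X=X\}\oplus i\{X\in\mathfrak g_{\mathbb R}:\sigma X=-X\}$, a real form of $\mathfrak g$. *)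

(* Defs.v *)
From HB Require Import structures.
From mathcomp Require Import all_boot all_order all_algebra.
From mathcomp Require Import reals.
Set Implicit Arguments. Unset Strict Implicit. Unset Printing Implicit Defensive.
Import Order.TTheory GRing.Theory Num.Theory.
Local Open Scope ring_scope.

(* Data: the split real form g_R of g is a finite dimensional real Lie algebra
   (L, br); g = g_R (x) C is represented by pairs (X, Y) meaning X + iY. *)
Section Lie.
Variables (R : realType) (L : vectType R) (br : L -> L -> L).

Definition lie_algebra : Prop :=
  [/\ forall a x y z, br (a *: x + y) z = a *: br x z + br y z,
      forall a x y z, br z (a *: x + y) = a *: br z x + br z y,
      forall x, br x x = 0 &
      forall x y z, br x (br y z) + br y (br z x) + br z (br x y) = 0].

Definition bracket_span (U V : {vspace L}) : {vspace L} :=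
  <<[seq br u v | u <- vbasis U, v <- vbasis V]>>%VS.

Definition is_ideal (I : {vspace L}) : Prop :=
  forall x y, x \in I -> br y x \in I.

Definition solvable_sub (I : {vspace L}) : Prop :=
  exists n, iter n (fun J => bracket_span J J) I = 0%VS.

Definition semisimple : Prop :=
  forall I, is_ideal I -> solvable_sub I -> I = 0%VS.

Definition subalgebra (h : {vspace L}) : Prop :=
  forall x y, x \in h -> y \in h -> br x y \in h.

Definition nilpotent_sub (h : {vspace L}) : Prop :=
  exists n, iter n (fun J => bracket_span h J) h = 0%VS.

Definition cartan (h : {vspace L}) : Prop :=
  [/\ subalgebra h, nilpotent_sub h &
      forall x, (forall y, y \in h -> br x y \in h) -> x \in h].

Definition functional (h : {vspace L}) := 'Hom(subvs_of h, R^o).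

Definition ev (h : {vspace L}) (a : functional h) (x : L) : R := a (vsproj h x).

Definition root_space (h : {vspace L}) (a : functional h) (x : L) : Prop :=
  forall H, H \in h -> br H x = ev a H *: x.

Definition is_root (h : {vspace L}) (a : functional h) : Prop :=
  a != 0 /\ exists x, x != 0 /\ root_space a x.

Definition ad (x : L) : 'End(L) := linfun (br x).
Definition killing (x y : L) : R :=
  \tr (passmx.mxof (vbasis {:L}) (vbasis {:L}) (ad x \o ad y)%VF).

(* inner product on V = h_R^* induced by the Killing form on h_R:
   coordinates on a basis of h_R and the inverse Gram matrix *)
Definition gram (h : {vspace L}) : 'M[R]_(\dim h) :=
  \matrix_(i, j) killing (tnth (vbasis h) i) (tnth (vbasis h) j).
Definition coords (h : {vspace L}) (a : functional h) : 'rV[R]_(\dim h) :=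
  \row_i ev a (tnth (vbasis h) i).
Definition inner (h : {vspace L}) (a b : functional h) : R :=
  (coords a *m invmx (gram h) *m (coords b)^T) 0 0.

Definition refl (h : {vspace L}) (a l : functional h) : functional h :=
  l - (2 * inner l a / inner a a) *: a.

Definition in_weyl (h : {vspace L}) (s : 'End(functional h)) : Prop :=
  exists rs : seq (functional h), (forall a, a \in rs -> is_root a) /\
    forall l, s l = foldr (fun a f => refl a \o f) id rs l.

Definition in_I (h : {vspace L}) (s : 'End(functional h)) : Prop :=
  [/\ forall l, s (s l) = l,
      forall a b, inner (s a) (s b) = inner a b &
      forall a, is_root a <-> is_root (s a)].

Definition automorphism (f : 'End(L)) : Prop :=
  bijective f /\ forall x y, f (br x y) = br (f x) (f y).

Definition chevalley (h : {vspace L}) (X Hc : functional h -> L) (tau : 'End(L)) : Prop :=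
  [/\ (forall a, is_root a -> X a != 0 /\ root_space a (X a)) /\
      (forall a, is_root a -> Hc a \in h),
      forall a b : functional h, is_root a -> is_root b -> exists z : int, ev a (Hc b) = z%:~R,
      forall a, is_root a -> br (X a) (X (- a)) = - Hc a,
      (forall a, is_root a ->
        br (Hc a) (X a) = 2 *: X a /\ br (Hc a) (X (- a)) = - (2 *: X (- a))) /\
      (forall U : {vspace L}, (h <= U)%VS ->
          (forall a, is_root a -> X a \in U) -> U = fullv) &
      [/\ automorphism tau, forall x, tau (tau x) = x,
          forall H, H \in h -> tau H = - H &
          forall a, is_root a -> tau (X a) = X (- a)]].

Definition brC (p q : L * L) : L * L :=
  (br p.1 q.1 - br p.2 q.2, br p.1 q.2 + br p.2 q.1).

(* g_f = {X in g_R : f X = X} + i {X in g_R : f X = - X}; g_u = g_tau *)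
Definition real_form (f : 'End(L)) (p : L * L) : Prop :=
  f p.1 = p.1 /\ f p.2 = - p.2.

(* anti-C-linear extension of f to g *)
Definition extC (f : 'End(L)) (p : L * L) : L * L := (f p.1, - f p.2).

Definition inv_tau (h : {vspace L}) (tau sigma : 'End(L)) : Prop :=
  [/\ automorphism sigma, forall x, sigma (sigma x) = x,
      (sigma @: h)%VS = h &
      forall q, real_form tau q <-> exists p, real_form tau p /\ extC sigma p = q].

Definition rho_eq (h : {vspace L}) (sigma : 'End(L)) (s : 'End(functional h)) : Prop :=
  forall a H, H \in h -> ev (s a) H = ev a ((sigma^-1)%VF H).

Definition iso_to_split (sigma : 'End(L)) : Prop :=
  exists f1 f2 : 'End(L),
    let phi x := (f1 x, f2 x) in
    [/\ injective phi, forall x, real_form sigma (phi x),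
        forall p, real_form sigma p -> exists x, phi x = p &
        forall x y, phi (br x y) = brC (phi x) (phi y)].

End Lie.

(* Main.v *)
Require Import Defs.
From HB Require Import structures.
From mathcomp Require Import all_boot all_order all_algebra.
From mathcomp Require Import boolp reals.
From mathcomp Require Import zify ring lra.
Set Implicit Arguments. Unset Strict Implicit. Unset Printing Implicit Defensive.
Import Order.TTheory GRing.Theory Num.Theory.
Local Open Scope ring_scope.

(** An involution s of the Weyl group is a product of reflections in strongly
    orthogonal roots g_1, ..., g_k: a nontrivial s negates some root (otherwise
    it fixes a regular vector, hence is trivial), and one splits off the longest
    negated root and repeats.  There is a coweight lam with all g_i(lam) odd:
    over F_2 the only obstruction is a relation 2 q = sum of an odd number of
    the g_i with q in the lattice spanned by the roots negated by s, and this
    reduces to the parity of sum_i <a, g_i^v> for a single negated root a, which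
    follows from 4 = sum_i <a, g_i^v><g_i, a^v> and strong orthogonality.
    Conjugating lam by the Cayley transforms of the commuting sl_2's attached to
    the g_i produces E = sum_i g_i(lam)/2 (X_{g_i} - X_{-g_i}) + H' with
    g_i(H') = 0.  Then ad E is diagonalizable with integer eigenvalues and
    tau E = - E; the involution sigma = (-1)^(ad E) acts on h as s, commutes
    with tau, and i^(ad E) maps g_R isomorphically onto g_sigma. *)

(** Lifts of [s] abound, but their real forms differ. With [sigma] of the shape (-1)^(ad E)
    splitness is built in, and the work is to make it act on h as [s]. An E in h would give the
    trivial action there. Trading g(lam)/2 H_g for g(lam)/2 (X_g - X_{-g}) makes H_g the half-sum of
    two eigenvectors of ad E with eigenvalues g(lam) and -g(lam), so sigma negates H_g exactly when
    g(lam) is odd: this is the origin of the parity condition. Integrality of lam on all roots, and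
    not only on the negated ones, makes the eigenvalues of ad E integers; it is secured by a chamber
    in which the negated roots are combinations of negated simple roots. Orthogonality alone would
    not make the copies of sl_2 commute, since [X_g, X_{g'}] has weight g + g'; this weight has to
    be excluded as a root. *)

Section RootSystem.
Variables (R : realFieldType) (V : lmodType R) (B : V -> V -> R) (rs : seq V).
Hypothesis BC : forall x y, B x y = B y x.
Hypothesis Blin : forall a x y z, B (a *: x + y) z = a * B x z + B y z.
Hypothesis Bpos : forall x, x != 0 -> 0 < B x x.
Hypothesis rs0 : 0 \notin rs.

(** * Pairings, reflections and pairs of roots *)

Definition cn (x a : V) : R := 2 * B x a / B a a.
Definition rfl (a x : V) : V := x - cn x a *: a.

Hypothesis rs_rfl : forall a b, a \in rs -> b \in rs -> rfl a b \in rs.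
Hypothesis rs_int : forall a b, a \in rs -> b \in rs -> exists z : int, cn a b = z%:~R.
Hypothesis rs_red : forall a, a \in rs -> 2 *: a \notin rs.

Lemma B0l y : B 0 y = 0.
Proof. by have := Blin 1 0 0 y; rewrite scaler0 addr0; lra. Qed.
Lemma BDl x y z : B (x + y) z = B x z + B y z.
Proof. by rewrite -[x in LHS]scale1r Blin mul1r. Qed.
Lemma BZl a x z : B (a *: x) z = a * B x z.
Proof. by rewrite -[a *: x]addr0 Blin B0l addr0. Qed.
Lemma BNl x z : B (- x) z = - B x z.
Proof. by rewrite -scaleN1r BZl mulN1r. Qed.
Lemma BBl x y z : B (x - y) z = B x z - B y z.
Proof. by rewrite BDl BNl. Qed.
Lemma BDr x y z : B z (x + y) = B z x + B z y.
Proof. by rewrite !(BC z) BDl. Qed.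
Lemma BZr a x z : B z (a *: x) = a * B z x.
Proof. by rewrite !(BC z) BZl. Qed.
Lemma BNr x z : B z (- x) = - B z x.
Proof. by rewrite !(BC z) BNl. Qed.
Lemma BBr x y z : B z (x - y) = B z x - B z y.
Proof. by rewrite !(BC z) BBl. Qed.
Lemma Bsuml I (s : seq I) (P : pred I) (F : I -> V) z :
  B (\sum_(i <- s | P i) F i) z = \sum_(i <- s | P i) B (F i) z.
Proof. by apply: (big_morph (B^~ z)) => [x y|]; rewrite ?BDl ?B0l. Qed.
Lemma Bsumr I (s : seq I) (P : pred I) (F : I -> V) z :
  B z (\sum_(i <- s | P i) F i) = \sum_(i <- s | P i) B z (F i).
Proof. by rewrite BC Bsuml; apply: eq_bigr => i _; rewrite BC. Qed.
Lemma Bge0 x : 0 <= B x x.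
Proof. by have [->|/Bpos/ltW//] := eqVneq x 0; rewrite B0l. Qed.
Lemma Beq0 x : B x x = 0 -> x = 0.
Proof. by move=> h; have [//|/Bpos] := eqVneq x 0; rewrite h ltxx. Qed.

Lemma rs_neq0 a : a \in rs -> a != 0.
Proof. by apply: contraTneq => ->. Qed.
Lemma rs_gt0 a : a \in rs -> 0 < B a a.
Proof. by move=> /rs_neq0/Bpos. Qed.

Lemma cnDl x y a : cn (x + y) a = cn x a + cn y a.
Proof. by rewrite /cn BDl; ring. Qed.
Lemma cnZl c x a : cn (c *: x) a = c * cn x a.
Proof. by rewrite /cn BZl; ring. Qed.
Lemma cnNl x a : cn (- x) a = - cn x a.
Proof. by rewrite /cn BNl; ring. Qed.
Lemma cnBl x y a : cn (x - y) a = cn x a - cn y a.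
Proof. by rewrite cnDl cnNl. Qed.
Lemma cnNr x a : cn x (- a) = - cn x a.
Proof. by rewrite /cn !BNr BNl opprK; ring. Qed.
Lemma cnaa a : a != 0 -> cn a a = 2.
Proof. by move=> /Bpos h; rewrite /cn mulfK ?gt_eqF. Qed.
Lemma cn_eq0 x a : a != 0 -> (cn x a == 0) = (B x a == 0).
Proof. by move=> /Bpos h; rewrite /cn !mulf_eq0 invr_eq0 (gt_eqF h) pnatr_eq0 orbF. Qed.

Lemma rflD a x y : rfl a (x + y) = rfl a x + rfl a y.
Proof. by rewrite /rfl cnDl scalerDl opprD addrACA. Qed.
Lemma rflZ a c x : rfl a (c *: x) = c *: rfl a x.
Proof. by rewrite /rfl cnZl scalerBr scalerA. Qed.
Lemma rfl_opp a x : rfl (- a) x = rfl a x.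
Proof. by rewrite /rfl cnNr scaleNr scalerN opprK. Qed.
Lemma rflaa a : a != 0 -> rfl a a = - a.
Proof. by move=> h; rewrite /rfl cnaa // scaler_nat mulr2n opprD addrA subrr add0r. Qed.
Lemma rfl_orth a x : B x a = 0 -> rfl a x = x.
Proof. by move=> h; rewrite /rfl /cn h mulr0 mul0r scale0r subr0. Qed.
Lemma B_rfl a x y : a != 0 -> B (rfl a x) (rfl a y) = B x y.
Proof.
move=> a0; have h : B a a != 0 by rewrite gt_eqF ?Bpos.
rewrite /rfl !(BBl, BBr, BZl, BZr) /cn (BC a y); field; exact: h.
Qed.
Lemma rflK a : a != 0 -> involutive (rfl a).
Proof.
move=> a0 x; have h : B a a != 0 by rewrite gt_eqF ?Bpos.
rewrite {1}/rfl {2}/rfl cnBl cnZl cnaa // -addrA -opprD -scalerDl.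
have -> : cn x a + (cn x a - cn x a * 2) = 0 by ring.
by rewrite scale0r subr0.
Qed.

Lemma rsN a : a \in rs -> - a \in rs.
Proof. by move=> h; rewrite -rflaa ?rs_neq0 // rs_rfl. Qed.
Lemma rsNE a : (- a \in rs) = (a \in rs).
Proof. by apply/idP/idP => /rsN; rewrite ?opprK. Qed.

Lemma CauchySchwarz x y : B x y ^+ 2 <= B x x * B y y.
Proof.
have [->|y0] := eqVneq y 0; first by rewrite !(BC _ 0) !B0l mulr0 expr0n.
have h := Bpos y0; have := Bge0 (B y y *: x - B x y *: y).
rewrite !(BBl, BBr, BZl, BZr) (BC y x).
rewrite [leRHS](_ : _ = B y y * (B x x * B y y - B x y ^+ 2)); last by ring.
by rewrite pmulr_rge0 // subr_ge0.
Qed.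

Lemma CauchySchwarz_eq x y : y != 0 -> B x y ^+ 2 = B x x * B y y ->
  x = (cn x y / 2) *: y.
Proof.
move=> y0 e; have h := Bpos y0.
apply/eqP; rewrite -subr_eq0; apply/eqP/Beq0.
rewrite !(BBl, BBr, BZl, BZr) (BC y x) /cn.
have hy : B y y != 0 by rewrite gt_eqF.
have -> : B x x = B x y ^+ 2 / B y y by rewrite e mulfK.
by field.
Qed.

Lemma cn_prod_le4 a b : a \in rs -> b \in rs -> cn a b * cn b a <= 4.
Proof.
move=> ra rb; have ha := rs_gt0 ra; have hb := rs_gt0 rb.
rewrite /cn (BC b a).
have -> : 2 * B a b / B b b * (2 * B a b / B a a) = 4 * (B a b ^+ 2 / (B a a * B b b)).
  by field; rewrite !gt_eqF.
have : B a b ^+ 2 / (B a a * B b b) <= 1.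
  by rewrite ler_pdivrMr ?mulr_gt0 // mul1r CauchySchwarz.
lra.
Qed.

Lemma cn_prod_eq4 a b : a \in rs -> b \in rs -> cn a b * cn b a = 4 ->
  a = (cn a b / 2) *: b.
Proof.
move=> ra rb; have ha := rs_gt0 ra; have hb := rs_gt0 rb => e.
apply: CauchySchwarz_eq; first exact: rs_neq0.
have eq2 : cn a b * cn b a * (B a a * B b b) = 4 * B a b ^+ 2.
  by rewrite /cn (BC b a); field; rewrite !gt_eqF.
by move: eq2; rewrite e; lra.
Qed.

Lemma cn_gt0 a b : b \in rs -> (0 < cn a b) = (0 < B a b).
Proof. by move=> /rs_gt0 h; rewrite /cn pmulr_lgt0 ?invr_gt0 // pmulr_rgt0. Qed.

(** The pairings are positive integers with product at most 4 by Cauchy-Schwarz. Product 4 forces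
    proportionality: (2, 2) then gives equal roots, and (4, 1) a doubled root, excluded by
    [rs_red]. *)
Lemma cn_cases a b : a \in rs -> b \in rs -> a != b -> 0 < B a b ->
  cn a b = 1 \/ cn b a = 1 /\ (cn a b = 2 \/ cn a b = 3).
Proof.
move=> ra rb ab hB.
have [p ep] := rs_int ra rb; have [q eq] := rs_int rb ra.
have := cn_prod_le4 ra rb; have := @cn_prod_eq4 _ _ ra rb.
have : 0 < cn a b by rewrite cn_gt0.
have : 0 < cn b a by rewrite cn_gt0 // BC.
rewrite ep eq !ltr0z -intrM => q0 p0 pq4 pq.
have {}pq : p * q <= 4 by rewrite -(@ler_int R).
have [p1 | p2 | p3 | [p4 q1]] :
  [\/ p = 1, p = 2 /\ (q = 1 \/ q = 2), p = 3 /\ q = 1 | p = 4 /\ q = 1].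
- have hp : p = 1 \/ p = 2 \/ p = 3 \/ p = 4 by nia.
  have hq : (p = 1) \/ (p = 2 /\ (q = 1 \/ q = 2)) \/ (p = 3 /\ q = 1) \/ (p = 4 /\ q = 1).
    by case: hp => [|[|[|]]] hp; rewrite hp in pq *; lia.
  by case: hq => [|[|[|]]] hq; [apply: Or41|apply: Or42|apply: Or43|apply: Or44].
- by left; rewrite p1.
- case: p2 => [p2 [q1|q2]].
    by right; rewrite p2 q1; split=> //; left.
  case/eqP: ab; rewrite pq4 p2 ?q2 //.
  by rewrite divff ?scale1r // pnatr_eq0.
- by case: p3 => -> ->; right; split=> //; right.
- have := rs_red rb; suff -> : 2 *: b = a by rewrite ra.
  by rewrite pq4 p4 ?q1 //; congr (_ *: _); lra.
Qed.

Lemma rs_sub a b : a \in rs -> b \in rs -> a != b -> 0 < B a b -> a - b \in rs.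
Proof.
move=> ra rb ab h; have [e|[e _]] := cn_cases ra rb ab h.
  by have := rs_rfl rb ra; rewrite /rfl e scale1r.
by have := rs_rfl ra rb; rewrite /rfl e scale1r -opprB rsNE.
Qed.


(** Decrease of the measure in the inductions below, which count the members of [rs] with a given
    property. *)
Lemma count_lt (T : eqType) (p q : pred T) (s : seq T) x :
  (forall y, p y -> q y) -> x \in s -> q x -> ~~ p x -> (count p s < count q s)%N.
Proof.
move=> pq xs qx px; have : {in s, forall y, (p y + (y == x) <= q y)%N}.
  move=> y _; have [->|_] := eqVneq y x; first by rewrite qx (negPf px).
  by case E: (p y); rewrite ?(pq _ E).
move=> h; apply: (@leq_trans (count p s + count_mem x s)).
  by rewrite -addn1 leq_add2l -has_count has_pred1.
elim: s h {xs} => //= y s IH h.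
rewrite addnACA leq_add ?h ?mem_head // IH // => z zs.
by rewrite h // in_cons zs orbT.
Qed.

(** * Words in reflections *)

Definition act (w : seq V) (x : V) : V := foldr rfl x w.
Arguments act : simpl never.

Lemma act_cons a w x : act (a :: w) x = rfl a (act w x).
Proof. by []. Qed.
Lemma act_cat w1 w2 x : act (w1 ++ w2) x = act w1 (act w2 x).
Proof. by rewrite /act foldr_cat. Qed.
Lemma act_rcons w a x : act (rcons w a) x = act w (rfl a x).
Proof. by rewrite /act foldr_rcons. Qed.
Lemma actD w x y : act w (x + y) = act w x + act w y.
Proof. by elim: w => // a w IH; rewrite !act_cons IH rflD. Qed.
Lemma actZ w c x : act w (c *: x) = c *: act w x.
Proof. by elim: w => // a w IH; rewrite !act_cons IH rflZ. Qed.
Lemma actN w x : act w (- x) = - act w x.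
Proof. by rewrite -!scaleN1r actZ. Qed.
Lemma B_act w x y : {subset w <= rs} -> B (act w x) (act w y) = B x y.
Proof.
elim: w => // a w IH s; rewrite !act_cons B_rfl ?IH ?rs_neq0 ?s ?mem_head //.
by move=> b bw; rewrite s // in_cons bw orbT.
Qed.
Lemma act_rs w a : {subset w <= rs} -> a \in rs -> act w a \in rs.
Proof.
elim: w => // b w IH s ra; rewrite act_cons.
apply: rs_rfl; first by rewrite s ?mem_head.
by apply: IH => // c cw; rewrite s // in_cons cw orbT.
Qed.
Lemma act_rfl w a x : {subset w <= rs} -> act w (rfl a x) = rfl (act w a) (act w x).
Proof. by move=> s; rewrite /rfl actD actN actZ /cn !B_act. Qed.

(** * Positive systems, simple roots and the exchange condition *)

Section Positive.
Variable u : V.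
Hypothesis reg : forall a, a \in rs -> B a u != 0.

Definition posr a := (a \in rs) && (0 < B a u).
Definition simple a :=
  posr a && ~~ has (fun b => posr b && posr (a - b)) rs.

Lemma posr_rs a : posr a -> a \in rs.
Proof. by case/andP. Qed.
Lemma posr_gt0 a : posr a -> 0 < B a u.
Proof. by case/andP. Qed.
Lemma posrN a : a \in rs -> posr (- a) = ~~ posr a.
Proof.
move=> ra; rewrite /posr rsN // ra BNl /= oppr_gt0 -leNgt lt_neqAle.
by rewrite reg.
Qed.
Lemma simple_posr a : simple a -> posr a.
Proof. by case/andP. Qed.
Lemma simple_rs a : simple a -> a \in rs.
Proof. by move/simple_posr/posr_rs. Qed.
Lemma simple_indec a b c : simple a -> posr b -> posr c -> a <> b + c.
Proof.
move=> /andP[_ /hasPn h] pb pc e; have := h b (posr_rs pb).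
by rewrite pb e addrC addKr pc.
Qed.

(** Otherwise [a - b] is positive and [a] decomposes as [b + (a - b)]. *)
Lemma posr_sub_simple a b : simple a -> posr b -> b - a \in rs -> posr (b - a).
Proof.
move=> sa pb r; apply: contraT => n.
have p : posr (- (b - a)) by rewrite posrN.
by case: (simple_indec sa pb p); rewrite opprB addrC subrK.
Qed.

(** If [B b a <= 0], a non-negative multiple of [a] is added. Otherwise the reflection subtracts [a]
    one, two or three times, and every intermediate vector is a root, so [posr_sub_simple] applies
    at each step. *)
Lemma simple_rfl_posr a b : simple a -> posr b -> b != a -> posr (rfl a b).
Proof.
move=> sa pb ba; have [ra rb] := (simple_rs sa, posr_rs pb).
have [h|h] := lerP (B b a) 0.
  rewrite /posr rs_rfl // /rfl BBl BZl subr_gt0.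
  apply: le_lt_trans (posr_gt0 pb).
  rewrite pmulr_lle0 ?posr_gt0 ?simple_posr //.
  by rewrite leNgt cn_gt0 // -leNgt.
have pba : posr (b - a) by rewrite posr_sub_simple ?rs_sub.
have r2 : rfl a b \in rs by rewrite rs_rfl.
have [e|[_ [e|e]]] := cn_cases rb ra ba h.
- by rewrite /rfl e scale1r.
- move: r2; rewrite /rfl e scaler_nat mulr2n opprD addrA => r2.
  exact: posr_sub_simple.
(* The missing intermediate root [b - 2 a] is the reflection of [b - a]. *)
- have r1 : rfl a (b - a) \in rs by rewrite rs_rfl // posr_rs.
  move: r1 r2; rewrite /rfl cnBl e cnaa ?rs_neq0 //.
  have -> : 3 - 2 = 1 :> R by ring.
  rewrite scale1r => r1.
  rewrite scaler_nat !mulrS mulr0n addr0 !opprD !addrA => r2.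
  by apply: posr_sub_simple => //; apply: posr_sub_simple.
Qed.

(** Heights [B b u] lie in an ordered field, so well-foundedness comes from counting the positive
    roots of smaller height. *)
Lemma posr_ind (P : V -> Prop) :
  (forall b, posr b -> (forall c, posr c -> B c u < B b u -> P c) -> P b) ->
  forall b, posr b -> P b.
Proof.
move=> H b; have [n] := ubnP (count (fun c => posr c && (B c u < B b u)) rs).
elim: n b => // n IH b hn pb; apply: H => // c pc cb; apply: IH => //.
rewrite ltnS in hn; apply: leq_trans hn.
apply: (@count_lt _ _ _ _ c); rewrite ?posr_rs ?pc ?ltxx //.
by move=> d /andP[-> /lt_trans->].
Qed.

Definition srs := [seq a <- undup rs | simple a].

Lemma mem_srs a : (a \in srs) = simple a.
Proof.
rewrite mem_filter mem_undup; apply/andP/idP => [[]//|sa].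
by split=> //; apply: simple_rs.
Qed.
Lemma srs_uniq : uniq srs.
Proof. exact/filter_uniq/undup_uniq. Qed.

Lemma posr_decomp b : posr b ->
  exists c : V -> nat, b = \sum_(a <- srs) (c a)%:R *: a.
Proof.
elim/posr_ind => {}b pb IH; have [sb|] := boolP (simple b).
  exists (fun a => (a == b) : nat).
  rewrite (bigD1_seq b) ?mem_srs ?srs_uniq //= eqxx scale1r big1 ?addr0 //.
  by move=> a /negPf ->; rewrite scale0r.
rewrite /simple pb negbK => /hasP[c _ /andP[pc pbc]].
have := posr_gt0 pc; have := posr_gt0 pbc; rewrite BBl => h1 h2.
have [//| |f ef] := IH c; first by lra.
have [//| |g eg] := IH (b - c); first by rewrite BBl; lra.
exists (fun a => f a + g a)%N; rewrite -[b in LHS](subrK c) {1}eg {1}ef -big_split /=.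
by apply: eq_bigr => a _; rewrite natrD scalerDl addrC.
Qed.

Lemma simple_obtuse a b : simple a -> simple b -> a != b -> B a b <= 0.
Proof.
move=> sa sb ab; rewrite leNgt; apply/negP => h.
have r := rs_sub (simple_rs sa) (simple_rs sb) ab h.
have p := posr_sub_simple sb (simple_posr sa) r.
by case: (simple_indec sa (simple_posr sb) p); rewrite addrC subrK.
Qed.

(** Vectors at pairwise non-acute angles in an open half-space are independent: the terms with
    positive and with non-positive coefficients give one and the same vector, whose square norm is
    at most zero, and pairing it with [u] kills each coefficient. *)
Lemma simple_indep (c : V -> R) : \sum_(a <- srs) c a *: a = 0 ->
  forall a, simple a -> c a = 0.
Proof.
move=> e.
pose P := \sum_(a <- srs | 0 < c a) c a *: a.
pose N := \sum_(a <- srs | ~~ (0 < c a)) (- c a) *: a.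
have PN : P = N.
  move: e; rewrite (bigID (fun a => 0 < c a)) /= -/P => /eqP.
  rewrite addr_eq0 => /eqP->; rewrite -sumrN.
  by apply: eq_bigr => a _; rewrite scaleNr.
have P0 : P = 0.
  apply: Beq0; apply/eqP; rewrite eq_le Bge0 andbT {2}PN [B _ _]Bsuml big_seq_cond.
  apply: sumr_le0 => a /andP[]; rewrite mem_srs => sa pa.
  rewrite BZl Bsumr mulr_ge0_le0 ?(ltW pa) // big_seq_cond.
  apply: sumr_le0 => b /andP[]; rewrite mem_srs -leNgt => sb pb.
  rewrite BZr mulr_ge0_le0 ?oppr_ge0 // simple_obtuse //.
  by apply: contraTneq pa => ->; rewrite -leNgt.
have N0 : N = 0 by rewrite -PN.
have hP a : simple a -> ~~ (0 < c a).
  move=> sa; apply/negP => ca; have : B P u = 0 by rewrite P0 B0l.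
  move/eqP; rewrite Bsuml big_seq_cond psumr_eq0 => [|b /andP[]]; last first.
    by rewrite mem_srs => sb cb; rewrite BZl mulr_ge0 ?ltW // posr_gt0 ?simple_posr.
  move/allP => /(_ a); rewrite mem_srs sa ca => /(_ isT) /=.
  by rewrite BZl mulf_eq0 !gt_eqF // posr_gt0 ?simple_posr.
move=> a sa; apply/eqP; rewrite eq_le leNgt hP //= leNgt; apply/negP => ca.
have : B N u = 0 by rewrite N0 B0l.
move/eqP; rewrite Bsuml big_seq_cond psumr_eq0 => [|b /andP[]]; last first.
  by rewrite mem_srs -leNgt => sb cb; rewrite BZl mulr_ge0 ?oppr_ge0 // ltW ?posr_gt0 ?simple_posr.
move/allP => /(_ a); rewrite mem_srs sa (negPf (hP a sa)) => /(_ isT) /=.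
by rewrite BZl mulf_eq0 oppr_eq0 lt_eqF //= gt_eqF // posr_gt0 ?simple_posr.
Qed.

(** A positive root that is not simple pairs positively with some simple [a], since [B b b > 0].
    Then [rfl a b] is positive of smaller height, and the reflection in [b] is its conjugate by
    [a]. *)
Lemma rfl_simple_word b : b \in rs ->
  exists2 w, all simple w & forall x, rfl b x = act w x.
Proof.
suff H : forall b, posr b -> exists2 w, all simple w & forall x, rfl b x = act w x.
  move=> rb; have [/H//|] := boolP (posr b).
  by rewrite -posrN // => /H[w sw e]; exists w => // x; rewrite -e rfl_opp.
move=> {}b; elim/posr_ind => {}b pb IH.
have [sb|nsb] := boolP (simple b); first by exists [:: b]; rewrite /= ?sb.
have rb := posr_rs pb.
have [c ec] := posr_decomp pb.
have [a sa hab] : exists2 a, simple a & 0 < B b a.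
  have [/hasP[a]|/hasPn h] := boolP (has (fun a => 0 < B b a) srs).
    by rewrite mem_srs; exists a.
  have := rs_gt0 rb; rewrite {2}ec Bsumr ltNge => /negP[].
  rewrite big_seq; apply: sumr_le0 => a /h; rewrite -leNgt => h'.
  by rewrite BZr mulr_ge0_le0.
have ra := simple_rs sa.
have ba : b != a by apply: contraNneq nsb => ->.
have p := simple_rfl_posr sa pb ba.
have [||w sw e] := IH (rfl a b); first by [].
  rewrite /rfl BBl BZl ltrBlDr ltrDl pmulr_rgt0 ?posr_gt0 ?simple_posr //.
  by rewrite cn_gt0.
exists (a :: rcons w a); first by rewrite /= all_rcons sa.
move=> x; rewrite act_cons act_rcons -e.
have e2 y : rfl a y = act [:: a] y by [].
rewrite -[in LHS](rflK (rs_neq0 ra) x) -[X in rfl X (rfl a _)](rflK (rs_neq0 ra)).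
rewrite 2!(e2 (rfl a _)) -act_rfl //.
by move=> z; rewrite inE => /eqP->.
Qed.

Lemma act_simple_word w : {subset w <= rs} ->
  exists2 w', all simple w' & forall x, act w x = act w' x.
Proof.
elim: w => [|a w IH] s; first by exists [::].
have [|w1 sw1 e1] := IH; first by move=> c cw; rewrite s // in_cons cw orbT.
have [|w2 sw2 e2] := @rfl_simple_word a; first by rewrite s ?mem_head.
by exists (w2 ++ w1) => [|x]; rewrite ?all_cat ?sw2 // act_cat act_cons e1 e2.
Qed.

Lemma all_simple_rs w : all simple w -> {subset w <= rs}.
Proof. by move=> /allP s a /s/simple_rs. Qed.

(** Reading [w] from the right, the image of [a] turns negative at some letter [b]; just before, it
    equals [b] by [simple_rfl_posr], so the reflection in [a] cancels that letter. *)
Lemma exchange w a : all simple w -> simple a -> ~~ posr (act w a) ->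
  exists w', [/\ all simple w', size w' < size w & forall x, act w' x = act w (rfl a x)]%N.
Proof.
elim: w => [|b w IH] /=; first by move=> _ /simple_posr->.
case/andP => sb sw sa; have ws := all_simple_rs sw.
have [p|n _] := boolP (posr (act w a)); last first.
  have [w' [sw' l e]] := IH sw sa n.
  by exists (b :: w'); split=> [||x]; rewrite ?ltnS //= ?sb // !act_cons e.
rewrite act_cons; have [e _|ne] := eqVneq (act w a) b; last by rewrite simple_rfl_posr.
exists w; split=> // x; rewrite act_cons act_rfl // e rflK //.
exact/rs_neq0/simple_rs.
Qed.

(** Freeness of the action on chambers: if a word of simple reflections ends in [a], the part before
    [a] must send [a] to a negative root, and [exchange] shortens the word. *)
Lemma act_posr_id w : {subset w <= rs} ->
  (forall a, posr a -> posr (act w a)) -> forall x, act w x = x.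
Proof.
move=> /act_simple_word[w' sw' e] H x; rewrite e.
have {e}H a : posr a -> posr (act w' a) by rewrite -e; apply: H.
have [n] := ubnP (size w'); elim: n w' sw' H => // n IH w'.
case/lastP: w' => // w' a; rewrite all_rcons size_rcons ltnS => /andP[sa sw] H hn.
have : posr (act (rcons w' a) a) by apply/H/simple_posr.
have ra := simple_rs sa; have rw := all_simple_rs sw.
rewrite act_rcons rflaa ?rs_neq0 // actN posrN ?act_rs // => /(exchange sw sa)[v [sv lv ev]].
have E y : act (rcons w' a) y = act v y by rewrite act_rcons ev.
rewrite E; apply: IH => //; last exact: ltn_trans lv hn.
by move=> b /H; rewrite E.
Qed.

End Positive.

(** * Generic vectors and the decomposition of involutions *)

Lemma avoid_scalars (ts : seq R) : exists t : R, t \notin ts.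
Proof.
pose c := \sum_(x <- ts) `|x|; exists (1 + c); apply/negP => tin.
have e : c = `|1 + c| + \sum_(x <- rem (1 + c) ts) `|x|.
  by rewrite {1}/c (perm_big _ (perm_to_rem tin)) big_cons.
have h1 := ler_norm (1 + c).
have h2 : 0 <= \sum_(x <- rem (1 + c) ts) `|x| by rewrite sumr_ge0.
by lra.
Qed.

Lemma avoid_hyperplanes (cs : seq V) : 0 \notin cs ->
  exists y, forall c, c \in cs -> B c y != 0.
Proof.
elim: cs => [|c cs IH]; first by exists 0.
rewrite in_cons negb_or eq_sym => /andP[c0 /IH[y hy]].
have [e|n] := eqVneq (B c y) 0; last first.
  by exists y => d; rewrite in_cons => /predU1P[->|/hy].
have [t] := avoid_scalars (0 :: [seq - B d y / B d c | d <- cs]).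
rewrite in_cons negb_or => /andP[t0 ht]; exists (y + t *: c) => d.
rewrite in_cons BDr BZr => /predU1P[->|dc].
  by rewrite e add0r mulf_neq0 // gt_eqF ?Bpos.
have [e'|n] := eqVneq (B d c) 0; first by rewrite e' mulr0 addr0 hy.
apply: contraNneq ht => e'; apply/mapP; exists d => //.
by apply: (mulIf n); rewrite mulfVK //; lra.
Qed.

Lemma B_act_sym w x y : {subset w <= rs} -> involutive (act w) ->
  B (act w x) y = B x (act w y).
Proof. by move=> ws inv; rewrite -[in LHS](inv y) B_act. Qed.

(** For [y] off the hyperplanes orthogonal to the non-zero vectors [a + act w a], the vector
    [y + act w y] is fixed and regular, so [w] preserves the positive system it defines. *)
Lemma act_id w : {subset w <= rs} -> involutive (act w) ->
  (forall a, a \in rs -> act w a != - a) -> forall x, act w x = x.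
Proof.
move=> ws inv na; have [|y hy] := @avoid_hyperplanes [seq a + act w a | a <- rs].
  apply/mapP => -[a ra] /esym/eqP; rewrite addrC addr_eq0; exact/negP/na.
pose u := y + act w y.
have Bu a : B a u = B (a + act w a) y by rewrite /u BDr BDl B_act_sym.
apply: (@act_posr_id u) => // [a ra|a]; first by rewrite Bu hy //; apply: (map_f (fun a => a + act w a)).
by rewrite /posr => /andP[ra]; rewrite act_rs // !Bu inv addrC.
Qed.

Lemma max_seq (T : eqType) (f : T -> R) (s : seq T) x0 : x0 \in s ->
  exists2 x, x \in s & forall y, y \in s -> f y <= f x.
Proof.
elim: s x0 => // a [_ x0 _|b s IH x0 _].
  by exists a; rewrite ?mem_head // => y; rewrite inE => /eqP->.
have [x xs hx] := IH b (mem_head _ _).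
have [h|h] := lerP (f a) (f x).
  exists x; first by rewrite in_cons xs orbT.
  by move=> y; rewrite in_cons => /predU1P[->|/hx].
exists a; first exact: mem_head.
move=> y; rewrite in_cons => /predU1P[->//|/hx hy].
exact: le_trans hy (ltW h).
Qed.

Definition strongly_orth (G : seq V) := {in G &, forall g g', g != g' ->
  [/\ B g g' = 0, g + g' \notin rs & g - g' \notin rs]}.

(* Choosing the longest root negated by the involution makes orthogonality strong. *)
Lemma involution_decomp w : {subset w <= rs} -> involutive (act w) ->
  exists G : seq V, [/\ uniq G, {subset G <= rs}, strongly_orth G,
    forall g, g \in G -> act w g = - g &
    forall x, act w x = x - \sum_(g <- G) cn x g *: g].
Proof.
have [n] := ubnP (count (fun a => act w a == - a) rs).
elim: n w => // n IH w hn ws inv.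
pose ng := [seq a <- rs | act w a == - a].
have [e|[a0 ha0]] : ng = [::] \/ exists a, a \in ng.
- by case: ng => [|a s]; [left|right; exists a; rewrite mem_head].
- exists [::]; split=> // x; rewrite big_nil subr0; apply: act_id => // a ra.
  apply/negP => h; suff : a \in ng by rewrite e.
  by rewrite mem_filter h.
have [g gng gmax] := max_seq (fun a => B a a) ha0.
move: gng; rewrite mem_filter => /andP[/eqP wg rg].
have g0 := rs_neq0 rg.
pose w' := rcons w g.
have w's : {subset w' <= rs}.
  by move=> a; rewrite mem_rcons in_cons => /predU1P[->//|/ws].
have comm x : act w (rfl g x) = rfl g (act w x) by rewrite act_rfl // wg rfl_opp.
have inv' : involutive (act w') by move=> x; rewrite !act_rcons comm inv rflK.
have w'g : act w' g = g by rewrite act_rcons rflaa // actN wg opprK.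
(* As [w'] fixes [g], a vector that it negates is orthogonal to [g], hence already negated by
   [w]. *)
have orth a : act w' a = - a -> B a g = 0 /\ act w a = - a.
  move=> e; have o : B a g = 0.
    by have := B_act a g w's; rewrite e w'g BNl; lra.
  by split=> //; rewrite -e act_rcons rfl_orth.
have [||//|G [uG rG sG nG eG]] := IH w'.
- rewrite ltnS in hn; apply: leq_trans hn.
  apply: (@count_lt _ _ _ _ g) => //; rewrite ?wg ?w'g //.
    by move=> y /eqP/orth[_ ->].
  by rewrite -addr_eq0 -mulr2n -scaler_nat scaler_eq0 negb_or g0 pnatr_eq0.
- by [].
have GE g' : g' \in G -> [/\ B g' g = 0, act w g' = - g', g' \in rs & 0 < B g' g'].
  by move=> hg; have [o e] := orth _ (nG _ hg); split; rewrite ?rs_gt0 ?rG.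
have gG : g \notin G.
  by apply/negP => /GE[o _ _]; rewrite o ltxx.
have long a : a \in rs -> act w a = - a -> B g g < B a a -> False.
  by move=> ra wa; rewrite ltNge gmax // mem_filter wa eqxx.
(* By orthogonality [g + g'] and [g - g'] both have square norm [B g g + B g' g']; being negated by
   [w], as roots they would be longer than the longest negated root. *)
have so g' : g' \in G -> [/\ B g g' = 0, g + g' \notin rs & g - g' \notin rs].
  move=> /GE[o e r p]; split; first by rewrite BC.
    apply/negP => /long; rewrite actD wg e opprD => /(_ erefl); apply.
    by rewrite BDl !BDr (BC g g') o; lra.
  apply/negP => /long; rewrite actD actN wg e opprD => /(_ erefl); apply.
  by rewrite BDl !BDr !BNl !BNr (BC g g') o; lra.
exists (g :: G); split.
- by rewrite /= gG.
- by move=> a; rewrite in_cons => /predU1P[->//|/rG].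
- move=> a b; rewrite !in_cons => /predU1P[->|ha] /predU1P[->|hb] ab.
  + by rewrite eqxx in ab.
  + exact: so.
  + have [h1 h2 h3] := so _ ha.
    by split; [rewrite BC|rewrite addrC|rewrite -rsNE opprB].
  + exact: sG.
- by move=> a; rewrite in_cons => /predU1P[->//|/GE[]].
move=> x; rewrite -{1}(rflK g0 x) -act_rcons -/w' eG big_cons {1}/rfl opprD addrA.
congr (_ - _); rewrite !big_seq; apply: eq_bigr => g' /GE[o _ _ _].
by rewrite /rfl /cn BBl BZl (BC g g') o mulr0 subr0.
Qed.

(** * Parity of the pairings with strongly orthogonal roots *)

Lemma int_choice (T : eqType) (f : T -> R) (s : seq T) :
  (forall x, x \in s -> exists z : int, f x = z%:~R) ->
  exists N : T -> int, forall x, x \in s -> f x = (N x)%:~R.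
Proof.
elim: s => [|x s IH] h; first by exists (fun=> 0).
have [|N hN] := IH; first by move=> y ys; apply: h; rewrite in_cons ys orbT.
have [z hz] := h x (mem_head _ _).
exists (fun y => if y == x then z else N y) => y; rewrite in_cons.
by case: (eqVneq y x) => [->|_] //= /hN.
Qed.

Lemma intr_eqn (z : int) (n : nat) : z%:~R = n%:R :> R -> z = n.
Proof. by move/eqP; rewrite pmulrn eqr_int => /eqP. Qed.

(** Non-proportional, non-orthogonal roots have a pairing equal to 1 or -1, so [N * M - N] is odd
    only for the pairs (1, 2) and (-1, -2). Away from these, the sum of the products [N * M]
    controls the parity of the sum of the [N]. *)
Lemma cn_parity a g (N M : int) : a \in rs -> g \in rs ->
  cn a g = N%:~R -> cn g a = M%:~R ->
  (exists k : int, N * M - N = 2 * k) \/ (N = 1 /\ M = 2) \/ (N = -1 /\ M = -2).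
Proof.
have pos g' (N' M' : int) : a \in rs -> g' \in rs ->
    cn a g' = N'%:~R -> cn g' a = M'%:~R -> 0 < B a g' ->
    (exists k : int, N' * M' - N' = 2 * k) \/ (N' = 1 /\ M' = 2).
  move=> ra rg eN eM h; have [e|ne] := eqVneq a g'.
    left; exists 1; move: eN eM; rewrite -e cnaa ?rs_neq0 //.
    by move=> /esym/intr_eqn-> /esym/intr_eqn->.
  have := cn_cases ra rg ne h; rewrite BC in h.
  rewrite eq_sym in ne; have := cn_cases rg ra ne h; rewrite eN eM.
  move=> H1 H2.
  have {}H1 : M' = 1 \/ N' = 1 /\ (M' = 2 \/ M' = 3).
    by case: H1 => [/(@intr_eqn _ 1)|[/(@intr_eqn _ 1)-> [] /intr_eqn]]; auto.
  have {}H2 : N' = 1 \/ M' = 1 /\ (N' = 2 \/ N' = 3).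
    by case: H2 => [/(@intr_eqn _ 1)|[/(@intr_eqn _ 1)-> [] /intr_eqn]]; auto.
  case: H1 => [->|[-> [->|->]]]; [left; exists 0|by right|left; exists 1]; lia.
move=> ra rg eN eM; have [h|h|h] := ltrgt0P (B a g).
- by have [|] := pos g N M ra rg eN eM h; auto.
- have [||||[k e]|[e1 e2]] := pos (- g) (- N) (- M) ra; rewrite ?rsN ?cnNr ?cnNl ?eN ?eM ?mulrNz ?BNr ?oppr_gt0 //.
    by left; exists (k - N); lia.
  by right; right; lia.
- left; exists 0; suff -> : N = 0 by rewrite mul0r subr0 mulr0.
  by apply/eqP; rewrite -(@intr_eq0 R) -eN cn_eq0 ?rs_neq0 // h.
Qed.

Lemma mulz_eq2 (p q : int) : p * q = 2 -> p = 1 \/ p = -1 \/ p = 2 \/ p = -2.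
Proof.
move=> e; have [q0|[q0|q0]] : (q <= -1) \/ q = 0 \/ (1 <= q) by lia.
- by have h : p < 0 by [nia]; have : -2 <= p by [nia]; lia.
- by subst; lia.
- by have h : 0 < p by [nia]; have : p <= 2 by [nia]; lia.
Qed.

Lemma mulz_eq1 (p q : int) : p * q = 1 -> p = 1 \/ p = -1.
Proof.
move=> e; have [q0|[q0|q0]] : (q <= -1) \/ q = 0 \/ (1 <= q) by lia.
- by have h : p < 0 by [nia]; have : -1 <= p by [nia]; lia.
- by subst; lia.
- by have h : 0 < p by [nia]; have : p <= 1 by [nia]; lia.
Qed.

Lemma addz_eq2 (x y : int) : 0 <= x -> 0 <= y -> x != 0 -> y != 0 -> x + y = 2 -> x = 1.
Proof. by lia. Qed.

(** The terms [N g * M g] are non-negative and vanish only together with [N g]. Without an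
    exceptional pair from [cn_parity], the value 4 of their sum gives the parity at once. An
    exceptional [g1] accounts for 2 of the 4, which leaves at most two further roots. *)
Lemma strongly_orth_parity (G : seq V) a : uniq G -> {subset G <= rs} ->
  strongly_orth G -> a \in rs -> 2 *: a = \sum_(g <- G) cn a g *: g ->
  exists k : int, \sum_(g <- G) cn a g = (2 * k)%:~R.
Proof.
move=> uG rG sG ra ea.
have [|N hN] := @int_choice _ (cn a) G; first by move=> g /rG rg; apply: rs_int.
have [|M hM] := @int_choice _ (cn^~ a) G; first by move=> g /rG rg; apply: rs_int.
have ea2 : 2 *: a = \sum_(g <- G) (N g)%:~R *: g.
  by rewrite ea !big_seq; apply: eq_bigr => g /hN->.
have e4 : \sum_(g <- G) N g * M g = 4.
  apply: (@intr_inj R); rewrite rmorph_sum /= big_seq.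
  under eq_bigr => g hg do rewrite rmorphM /= -hN // -hM //.
  rewrite -big_seq.
  have -> : \sum_(g <- G) cn a g * cn g a = cn (\sum_(g <- G) cn a g *: g) a.
    rewrite /cn Bsuml mulr_sumr mulr_suml; apply: eq_bigr => g _.
    by rewrite BZl; ring.
  by rewrite -ea cnZl cnaa ?rs_neq0 //; ring.
suff [k hk] : exists k : int, \sum_(g <- G) N g = 2 * k.
  by exists k; rewrite -hk rmorph_sum /= !big_seq; apply: eq_bigr => g /hN.
have NM0 g : g \in G -> 0 <= N g * M g /\ (N g * M g = 0 -> N g = 0).
  move=> gG; have rg := rG _ gG.
  have e : cn a g * cn g a = 4 * B a g ^+ 2 / (B a a * B g g).
    by rewrite /cn (BC g a); field; rewrite !gt_eqF ?rs_gt0.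
  have hp : 0 < B a a * B g g by rewrite mulr_gt0 ?rs_gt0.
  split; first by rewrite -(@ler0z R) rmorphM /= -hN // -hM // e divr_ge0 ?(ltW hp) // mulr_ge0 // sqr_ge0.
  move=> z; apply/eqP; rewrite -(@intr_eq0 R) -hN // cn_eq0 ?rs_neq0 //.
  have : cn a g * cn g a == 0 by rewrite hN // hM // -rmorphM z.
  by rewrite e !mulf_eq0 invr_eq0 (gt_eqF hp) pnatr_eq0 orbF orbb.
have [/hasP[g1 g1G /orP h]|/hasPn h] := boolP
  (has (fun g => ((N g == 1) && (M g == 2)) || ((N g == -1) && (M g == -2))) G); last first.
  suff [k hk] : exists k : int, \sum_(g <- G) (N g * M g - N g) = 2 * k.
    by exists (2 - k); move: hk; rewrite sumrB e4; move: (\sum_(g <- G) N g) => S; lia.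
  elim: G {uG sG ea ea2 e4 NM0} rG hN hM h => [|g G IH] rG hN hM h; first by exists 0; rewrite big_nil.
  have [||||k hk] := IH; try by move=> x xG; (apply: rG || apply: hN || apply: hM || apply: h); rewrite in_cons xG orbT.
  have gG := mem_head g G.
  rewrite big_cons hk.
  have [[k' ->]|n] := cn_parity ra (rG _ gG) (hN _ gG) (hM _ gG).
    by exists (k' + k); rewrite mulrDr.
  by move: (h _ gG) => /negP[]; case: n => [[-> ->]|[-> ->]].
(* Here the reflection of g1 in a is, up to sign, the combination of the other g. *)
have [e e1 [eN eM]] : exists2 e : int, e = 1 \/ e = -1 & N g1 = e /\ M g1 = 2 * e.
  by case: h => /andP[/eqP-> /eqP->]; [exists 1|exists (-1)]; auto.
pose G2 := [seq g <- rem g1 G | N g != 0].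
have pG := perm_to_rem g1G.
have G2G g : g \in G2 -> [/\ g \in G, N g != 0 & g != g1].
  rewrite mem_filter mem_rem_uniq // inE => /andP[n /andP[ne gG]].
  by split.
have uG2 : uniq G2 by rewrite filter_uniq ?rem_uniq.
have sum2 (W : zmodType) (F : V -> W) : (forall g, N g = 0 -> F g = 0) ->
    \sum_(g <- G) F g = F g1 + \sum_(g <- G2) F g.
  move=> F0; rewrite (perm_big _ pG) big_cons; congr (_ + _).
  rewrite /G2 big_filter [RHS]big_mkcond; apply: eq_bigr => g _.
  by case: eqP => //= /F0.
have s2 : \sum_(g <- G2) N g * M g = 2.
  have := sum2 _ (fun g => N g * M g); rewrite e4 eN eM => h2.
  have {h2} := h2 (fun g z => etrans (congr1 (fun t => t * M g) z) (mul0r _)).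
  move: (\sum_(g <- G2) _) => S; case: e1 => ->; lia.
have dG2 : \sum_(g <- G2) (N g)%:~R *: g \in rs.
  have r := rs_rfl ra (rG _ g1G).
  have E : 2 *: a = e%:~R *: g1 + \sum_(g <- G2) (N g)%:~R *: g.
    by rewrite ea2 sum2 ?eN // => g ->; rewrite scale0r.
  move: r; rewrite /rfl (hM _ g1G) eM.
  rewrite mulrC rmorphM /= -scalerA E.
  move: (\sum_(g <- G2) _) => S; case: e1 => ->.
    by rewrite !scale1r opprD addrA subrr sub0r rsNE.
  by rewrite (_ : (-1)%:~R = -1 :> R) // !scaleN1r opprK addrA subrr add0r.
(* The remaining terms sum to 2. A single root has coefficient 1 or -1, as 2 or -2 would make its
   double a root. Two roots would have coefficients 1 or -1, making their sum or difference a root.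
   Three roots would exceed 2. *)
rewrite sum2 // eN.
case E2 : G2 => [|g2 [|g3 [|g4 G4]]]; move: s2 dG2 uG2.
- by rewrite E2 big_nil.
- rewrite E2 !big_seq1 => s2 d2 _.
  have [g2G n2 _] : [/\ g2 \in G, N g2 != 0 & g2 != g1] by apply: G2G; rewrite E2 mem_head.
  have := mulz_eq2 s2.
  case=> [->|[->|[e2|e2]]].
  + by exists ((e + 1) %/ 2)%Z; case: e1 => ->.
  + by exists ((e - 1) %/ 2)%Z; case: e1 => ->.
  + by move: (rs_red (rG _ g2G)); rewrite e2 in d2; rewrite d2.
  + by move: (rs_red (rG _ g2G)); rewrite e2 mulrNz scaleNr rsNE in d2; rewrite d2.
- rewrite E2 !big_cons !big_nil !addr0 /= inE => s2 d2 /andP[n23 _].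
  have [g2G n2 _] : [/\ g2 \in G, N g2 != 0 & g2 != g1] by apply: G2G; rewrite E2 mem_head.
  have [g3G n3 _] : [/\ g3 \in G, N g3 != 0 & g3 != g1] by apply: G2G; rewrite E2 !inE eqxx orbT.
  have [h2 h2'] := NM0 _ g2G; have [h3 h3'] := NM0 _ g3G.
  have [_ np nm] := sG _ _ g2G g3G n23.
  have {}h2' : N g2 * M g2 != 0 by apply: contra n2 => /eqP/h2'->.
  have {}h3' : N g3 * M g3 != 0 by apply: contra n3 => /eqP/h3'->.
  have /mulz_eq1 := addz_eq2 h2 h3 h2' h3' s2.
  rewrite addrC in s2; have /mulz_eq1 := addz_eq2 h3 h2 h3' h2' s2.
  move=> [e3|e3] [e2|e2]; move: d2; rewrite e2 e3 ?mulrNz ?scaleNr !scale1r.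
  + by rewrite (negPf np).
  + by rewrite addrC -rsNE opprB (negPf nm).
  + by rewrite (negPf nm).
  + by rewrite -opprD rsNE (negPf np).
- have pos4 g : g \in G2 -> 1 <= N g * M g.
    move=> /G2G[gG n _]; have [h1 h2] := NM0 _ gG.
    have {h2} : N g * M g != 0 by apply: contra n => /eqP/h2->.
    by rewrite -gtz0_ge1 lt0r h1 andbT.
  have : 3 <= \sum_(g <- G2) N g * M g; last by move=> h3 e2; rewrite e2 in h3.
  rewrite E2 !big_cons.
  have := pos4 g2; have := pos4 g3; have := pos4 g4; rewrite E2 !inE !eqxx !orbT.
  move=> /(_ isT) h4 /(_ isT) h3 /(_ isT) h2.
  have : 0 <= \sum_(j <- G4) N j * M j.
    rewrite big_seq sumr_ge0 // => g gG4; apply: le_trans (pos4 g _) => //.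
    by rewrite E2 !inE gG4 !orbT.
  move=> h5; rewrite -[3]/(1 + (1 + (1 + 0)) : int).
  by rewrite !lerD.
Qed.

(** * Linear algebra over F_2 and the odd coweight *)

Lemma sum_nthE (W : zmodType) (s : seq V) (F : V -> W) :
  \sum_(a <- s) F a = \sum_(i < size s) F s`_i.
Proof. by rewrite (big_nth 0) big_mkord. Qed.

(** Coweights are prescribed on simple roots. The Gram matrix is invertible because a kernel vector
    gives a combination of simple roots orthogonal to itself. *)
Lemma simple_dual u (reg : forall a, a \in rs -> B a u != 0) (t : V -> R) :
  exists y, forall a, simple u a -> B a y = t a.
Proof.
pose n := size (srs u); pose S (i : 'I_n) := (srs u)`_i.
pose A : 'M[R]_n := \matrix_(i, j) B (S i) (S j).
have uA : A \in unitmx.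
  rewrite unitmxE unitfE; apply/det0P => -[v v0 vA].
  pose x := \sum_i v 0 i *: S i.
  have Bx j : B x (S j) = 0.
    have := congr1 (fun M : 'rV_n => M 0 j) vA; rewrite !mxE => <-.
    by rewrite Bsuml; apply: eq_bigr => i _; rewrite BZl mxE.
  have x0 : x = 0 by apply: Beq0; rewrite {2}/x Bsumr big1 // => i _; rewrite BZr Bx mulr0.
  pose c a := if insub (index a (srs u)) is Some i then v 0 i else 0.
  have cS i : c (S i) = v 0 i.
    rewrite /c index_uniq ?srs_uniq ?ltn_ord //.
    by case: insubP => [k _ /val_inj->//|]; rewrite ltn_ord.
  case/eqP: v0; apply/rowP => i; rewrite mxE -cS.
  apply: (@simple_indep u) => //; last by rewrite -mem_srs mem_nth ?ltn_ord.
  by rewrite sum_nthE -[RHS]x0; apply: eq_bigr => k _; rewrite -/(S k) cS.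
pose z := invmx A *m (\col_i t (S i)).
exists (\sum_j z j 0 *: S j) => a; rewrite -mem_srs => ha.
have hi : (index a (srs u) < n)%N by rewrite index_mem.
have <- : S (Ordinal hi) = a by rewrite /S /= nth_index.
have : A *m z = \col_i t (S i) by rewrite mulKVmx.
move/(congr1 (fun M : 'cV_n => M (Ordinal hi) 0)); rewrite !mxE => <-.
by rewrite Bsumr; apply: eq_bigr => j _; rewrite BZr !mxE mulrC.
Qed.

Lemma F2_eq0 (z : int) : (z%:~R == 0 :> 'F_2) -> exists k : int, z = k * 2.
Proof.
have p2 : (2 \in [pchar 'F_2])%N by apply: pchar_Fp.
by rewrite -(dvdz_pcharf p2) => /dvdzP[k ->]; exists k.
Qed.

(** Fredholm alternative over F_2: the all-ones row lies in the row space of [M] when every column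
    of the cokernel kills it, and such a column lifts to an integer family [d] as in the
    hypothesis. *)
Lemma F2_solve (k n : nat) (c : 'I_k -> 'I_n -> int) :
  (forall d : 'I_k -> int, (forall j, exists q, \sum_i d i * c i j = q * 2) ->
     exists q, \sum_i d i = q * 2) ->
  exists f : 'I_n -> int, forall i, exists q, \sum_j c i j * f j = q * 2 + 1.
Proof.
move=> H.
pose M : 'M['F_2]_(n, k) := \matrix_(j, i) (c i j)%:~R.
have liftE (x : 'F_2) : ((x : nat) : int)%:~R = x by rewrite -[RHS]natr_Zp.
have /submxP[D eD] : ((const_mx 1 : 'rV['F_2]_k) <= M)%MS.
  rewrite submxE; apply/eqP/rowP => j; rewrite !mxE.
  pose d i : int := (cokermx M i j : nat).
  have [l|q hq] := H d.
    apply: F2_eq0; rewrite rmorph_sum /=.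
    have := congr1 (fun A : 'M_(n, k) => A l j) (mulmx_coker M).
    rewrite !mxE => E; apply/eqP; rewrite -[RHS]E.
    apply: eq_bigr => i _; rewrite rmorphM mulrC [M _ _]mxE; congr (_ * _).
    exact: liftE.
  transitivity ((\sum_i d i)%:~R : 'F_2).
    rewrite rmorph_sum; apply: eq_bigr => i _; rewrite mxE mul1r.
    exact/esym/liftE.
  by rewrite hq rmorphM /= (_ : 2%:~R = 0 :> 'F_2) ?mulr0 //; apply/eqP.
exists (fun j => (D 0 j : nat) : int) => i.
have [|q hq] := @F2_eq0 (\sum_j c i j * ((D 0 j : nat) : int) - 1); last first.
  by exists q; rewrite -hq subrK.
have := congr1 (fun A : 'rV_k => A 0 i) eD; rewrite !mxE => E.
rewrite rmorphB rmorph_sum rmorph1 subr_eq0 [eqbRHS]E; apply/eqP/eq_bigr => j _.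
by rewrite rmorphM /= liftE [M _ _]mxE mulrC.
Qed.

(** With such a [t], replacing [v] by [v + t *: u0] changes the sign of no non-zero pairing of [v]
    with [s]. *)
Lemma small_scalar (s : seq V) v u0 :
  exists2 t : R, 0 < t & forall a, a \in s -> B a v != 0 -> t * `|B a u0| < `|B a v|.
Proof.
elim: s => [|b s [t t0 ht]]; first by exists 1.
have [e|n] := eqVneq (B b v) 0.
  by exists t => // a; rewrite in_cons => /predU1P[->|/ht//]; rewrite e eqxx.
pose t2 := `|B b v| / (`|B b u0| + 1).
have p : 0 < `|B b u0| + 1 by rewrite ltr_wpDl.
have t20 : 0 < t2 by rewrite divr_gt0 ?normr_gt0.
exists (Num.min t t2); first by rewrite lt_min t0.
move=> a; rewrite in_cons => /predU1P[-> _|/ht h /h]; last first.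
  by apply: le_lt_trans; rewrite ler_wpM2r ?ge_min ?lexx.
apply: (@le_lt_trans _ _ (t2 * `|B b u0|)); first by rewrite ler_wpM2r ?ge_min ?lexx ?orbT.
by rewrite /t2 mulrAC ltr_pdivrMr // ltr_pM2l ?normr_gt0 // ltrDl ltr01.
Qed.

(* A chamber whose closure meets the fixed space of the involution in a generic
   point: the roots negated by w then form a standard parabolic subsystem. *)
Lemma adapted_chamber w : {subset w <= rs} -> involutive (act w) ->
  exists u, (forall a, a \in rs -> B a u != 0) /\
   forall b, posr u b -> act w b = - b ->
   exists c : V -> nat, b = \sum_(a <- srs u | act w a == - a) (c a)%:R *: a.
Proof.
move=> ws inv.
have [|y hy] := @avoid_hyperplanes [seq x <- [seq a + act w a | a <- rs] | x != 0].
  by rewrite mem_filter eqxx.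
(* [v] is fixed by the involution, and the roots orthogonal to it are exactly the negated ones. *)
pose v := y + act w y.
have Bv a : B a v = B (a + act w a) y by rewrite /v BDr BDl B_act_sym.
have v0 a : a \in rs -> (B a v == 0) = (act w a == - a).
  move=> ra; apply/idP/eqP => [|e]; last by rewrite Bv e subrr B0l.
  apply: contraTeq; rewrite -addr_eq0 addrC => n; rewrite Bv hy // mem_filter n.
  exact: (map_f (fun a => a + act w a)).
have [u0 hu0] := avoid_hyperplanes rs0.
have [t t0 ht] := small_scalar rs v u0.
have Bu a : B a (v + t *: u0) = B a v + t * B a u0 by rewrite BDr BZr.
have tn a : `|t * B a u0| = t * `|B a u0| by rewrite normrM gtr0_norm.
have reg a : a \in rs -> B a (v + t *: u0) != 0.
  move=> ra; rewrite Bu; have [e|n] := eqVneq (B a v) 0.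
    by rewrite e add0r mulf_neq0 ?hu0 // gt_eqF.
  have := ht a ra n; rewrite -tn; apply: contraTneq => e.
  by rewrite -leNgt (_ : t * B a u0 = - B a v) ?normrN //; lra.
have vge0 a : posr (v + t *: u0) a -> 0 <= B a v.
  move=> /andP[ra]; rewrite Bu => h; rewrite leNgt; apply/negP => n.
  have := ht a ra (negbT (lt_eqF n)); rewrite -tn (ltr0_norm n) => h2.
  by have := ler_norm (t * B a u0); lra.
exists (v + t *: u0); split=> // b pb wb.
have [c ec] := posr_decomp pb; exists c.
rewrite {1}ec [RHS]big_mkcond /= !big_seq; apply: eq_bigr => a.
rewrite mem_srs => sa; have ra := simple_rs sa.
case: ifP => // /negbT; rewrite -v0 // => n.
have [->|c0] := eqVneq (c a) 0%N; first by rewrite scale0r.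
(* The pairing with [v] is zero on [b] and non-negative on positive roots, so a simple root on which
   it is non-zero has coefficient zero in [b]. *)
have : B b v == 0 by rewrite v0 ?(posr_rs pb) // wb.
rewrite ec Bsuml big_seq psumr_eq0 => [|a']; last first.
  by rewrite mem_srs => sa'; rewrite BZl mulr_ge0 // vge0 ?simple_posr.
move/allP => /(_ a); rewrite mem_srs sa => /(_ isT) /=.
by rewrite BZl mulf_eq0 (negPf n) orbF pnatr_eq0 (negPf c0).
Qed.

(** The negated roots span a direct summand of the root lattice, with basis the negated simple roots
    [J]. A solution modulo 2 on [J] therefore extends by zero on the other simple roots and is
    integral on every root. *)
Lemma odd_coweight w G : {subset w <= rs} -> involutive (act w) ->
  uniq G -> {subset G <= rs} -> strongly_orth G ->
  (forall g, g \in G -> act w g = - g) ->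
  (forall x, act w x = x - \sum_(g <- G) cn x g *: g) ->
  exists y, (forall a, a \in rs -> exists z : int, B a y = z%:~R) /\
    forall g, g \in G -> exists z : int, B g y = (z * 2 + 1)%:~R.
Proof.
move=> ws inv uG rG sG nG eG.
have [u [reg hu]] := adapted_chamber ws inv.
pose J := [seq a <- srs u | act w a == - a].
have Jrs a : a \in J -> a \in rs by rewrite mem_filter mem_srs => /andP[_ /simple_rs].
have parJ a : a \in J -> exists k : int, \sum_(g <- G) cn a g = (2 * k)%:~R.
  move=> aJ; apply: strongly_orth_parity => //; first exact: Jrs.
  move: aJ; rewrite mem_filter => /andP[/eqP wa _].
  by have := eG a; rewrite wa scaler_nat mulr2n => /eqP; rewrite eq_sym subr_eq addrC -subr_eq opprK => /eqP.
have decG g : g \in G -> exists c : V -> int, g = \sum_(a <- J) (c a)%:~R *: a.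
  move=> gG; have rg := rG _ gG; have wg := nG _ gG.
  have [p|n] := boolP (posr u g).
    have [c ec] := hu g p wg; exists (fun a => c a : int).
    by rewrite big_filter.
  rewrite -posrN // in n; have [|c ec] := hu _ n; first by rewrite actN wg.
  exists (fun a => - (c a : int)); rewrite big_filter -[LHS]opprK ec -sumrN.
  by apply: eq_bigr => a _; rewrite mulrNz scaleNr.
pose k := size G; pose n := size J.
have Gin (i : 'I_k) : G`_i \in G by rewrite mem_nth.
have Jin (j : 'I_n) : J`_j \in J by rewrite mem_nth.
have [C hC] := fin_all_exists (fun i : 'I_k => decG _ (Gin i)).
have [P hP] := fin_all_exists (fun j : 'I_n => parJ _ (Jin j)).
have [d hd|f hf] := @F2_solve k n (fun i j => C i J`_j).
  have [q hq] := fin_all_exists hd.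
  (* Half of a relation modulo 2. By orthogonality its pairings with [G] return the coefficients
     [d], so the sum of the [d] is additive in [x] and its parity can be tested on each element of
     [J]. *)
  pose x := \sum_j (q j)%:~R *: J`_j.
  have e2 : \sum_(i < k) (d i)%:~R *: G`_i = 2 *: x.
    rewrite /x scaler_sumr.
    under eq_bigr => i _ do rewrite {1}(hC i) sum_nthE scaler_sumr.
    rewrite exchange_big /=; apply: eq_bigr => j _.
    rewrite scalerA -[2]/(2%:~R) -rmorphM /= mulrC -hq rmorph_sum scaler_suml.
    by apply: eq_bigr => i _; rewrite scalerA rmorphM.
  have cx (i : 'I_k) : cn x G`_i = (d i)%:~R.
    have : cn (2 *: x) G`_i = 2 * (d i)%:~R.
      rewrite -e2 /cn Bsuml (bigD1 i) //= big1 ?addr0 => [|j ji].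
        rewrite BZl mulrA mulfK ?gt_eqF ?rs_gt0 ?rG ?Gin //.
      have [|o _ _] := sG _ _ (Gin j) (Gin i); last by rewrite BZl o mulr0.
      by rewrite nth_uniq.
    by rewrite cnZl => /mulfI-> //; rewrite pnatr_eq0.
  exists (\sum_j q j * P j); apply: (@intr_inj R).
  rewrite rmorph_sum rmorphM rmorph_sum /= mulr_suml.
  under eq_bigr => i _ do rewrite -cx.
  have -> : \sum_(i < k) cn x G`_i = \sum_(g <- G) cn x g by rewrite sum_nthE.
  transitivity (\sum_j (q j)%:~R * \sum_(g <- G) cn J`_j g).
    under [RHS]eq_bigr => j _ do rewrite mulr_sumr.
    rewrite [RHS]exchange_big /=; apply: eq_bigr => g _.
    rewrite /cn /x Bsuml mulr_sumr mulr_suml; apply: eq_bigr => j _.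
    by rewrite BZl; ring.
  by apply: eq_bigr => j _; rewrite hP !rmorphM /=; ring.
pose t a := if insub (index a J) is Some j then (f j)%:~R else 0 : R.
have tJ (j : 'I_n) : t J`_j = (f j)%:~R.
  rewrite /t index_uniq ?ltn_ord ?(filter_uniq _ (srs_uniq u)) //.
  by case: insubP => [i _ /val_inj->//|]; rewrite ltn_ord.
have tint a : exists z : int, t a = z%:~R.
  by rewrite /t; case: (insub _) => [i|]; [exists (f i)|exists 0].
have [y hy] := simple_dual reg t.
exists y; split=> [a ra|g gG].
  have pint b : posr u b -> exists z : int, B b y = z%:~R.
    move=> /posr_decomp[c ->].
    have [|N hN] := @int_choice _ t (srs u); first by move=> x _; apply: tint.
    exists (\sum_(a <- srs u) (c a : int) * N a).
    rewrite Bsuml rmorph_sum /= !big_seq; apply: eq_bigr => b' hb'.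
    by rewrite BZl hy -?mem_srs // hN // rmorphM.
  have [/pint//|] := boolP (posr u a).
  by rewrite -posrN // => /pint[z hz]; exists (- z); rewrite mulrNz -hz BNl opprK.
have hi : (index g G < k)%N by rewrite index_mem.
have <- : G`_(Ordinal hi) = g by rewrite /= nth_index.
have [q hq] := hf (Ordinal hi); exists q.
rewrite -hq {1}(hC (Ordinal hi)) sum_nthE Bsuml rmorph_sum /=.
apply: eq_bigr => j _.
rewrite BZl rmorphM /= -tJ hy //.
by have := Jin j; rewrite mem_filter mem_srs => /andP[].
Qed.

End RootSystem.

(** * Brackets and exponentials of nilpotent derivations *)

Section LieAlgebra.
Variables (R : realType) (L : vectType R) (br : L -> L -> L).
Hypothesis lieL : lie_algebra br.

Lemma br_linear x : linear (br x).
Proof. by case: lieL => _ h _ _ a y z; rewrite h. Qed.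
Definition brl x : {linear L -> L} := HB.pack (br x)
  (GRing.isLinear.Build R L L *:%R (br x) (br_linear x)).

Lemma adE x y : ad br x y = br x y.
Proof. exact: (lfunE (brl x) y). Qed.
Lemma brDr x y z : br x (y + z) = br x y + br x z.
Proof. exact: (linearD (brl x)). Qed.
Lemma brZr x a y : br x (a *: y) = a *: br x y.
Proof. exact: (linearZ_LR (brl x)). Qed.
Lemma brNr x y : br x (- y) = - br x y.
Proof. exact: (linearN (brl x)). Qed.
Lemma brBr x y z : br x (y - z) = br x y - br x z.
Proof. exact: (linearB (brl x)). Qed.
Lemma br0r x : br x 0 = 0.
Proof. exact: (linear0 (brl x)). Qed.
Lemma br_sumr I (s : seq I) (P : pred I) (F : I -> L) x :
  br x (\sum_(i <- s | P i) F i) = \sum_(i <- s | P i) br x (F i).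
Proof. exact: (linear_sum (brl x)). Qed.
Lemma brxx x : br x x = 0.
Proof. by case: lieL. Qed.
Lemma br_anti x y : br x y = - br y x.
Proof.
have [h _ a _] := lieL; have := a (1 *: x + y).
rewrite h brDr brZr brDr brZr !brxx !scale1r addr0 add0r => /eqP.
by rewrite addr_eq0 => /eqP.
Qed.
Lemma brDl x y z : br (x + y) z = br x z + br y z.
Proof. by rewrite br_anti brDr opprD -!br_anti. Qed.
Lemma brZl a x z : br (a *: x) z = a *: br x z.
Proof. by rewrite br_anti brZr -scalerN -br_anti. Qed.
Lemma brNl x z : br (- x) z = - br x z.
Proof. by rewrite br_anti brNr -br_anti. Qed.
Lemma brBl x y z : br (x - y) z = br x z - br y z.
Proof. by rewrite brDl brNl. Qed.
Lemma br0l z : br 0 z = 0.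
Proof. by rewrite br_anti br0r oppr0. Qed.
Lemma br_suml I (s : seq I) (P : pred I) (F : I -> L) z :
  br (\sum_(i <- s | P i) F i) z = \sum_(i <- s | P i) br (F i) z.
Proof. by rewrite br_anti br_sumr -sumrN; apply: eq_bigr => i _; rewrite -br_anti. Qed.
Lemma jacobi x y z : br x (br y z) = br (br x y) z + br y (br x z).
Proof.
have [_ _ _ h] := lieL; have := h x y z.
rewrite (br_anti z (br x y)) (br_anti z x) brNr => /eqP.
by rewrite subr_eq0 subr_eq => /eqP.
Qed.

Section Exponential.
Variables (D : 'End(L)) (n : nat).
Hypothesis derD : forall x y, D (br x y) = br (D x) y + br x (D y).
Hypothesis nilD : forall x, iter n D x = 0.

(** Divided powers: their Leibniz rule [dp_br] carries no binomial coefficients. *)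
Definition dp k (x : L) : L := (k`!%:R)^-1 *: iter k D x.

Lemma dpS k x : (k.+1)%:R *: dp k.+1 x = D (dp k x).
Proof.
rewrite /dp [RHS]linearZ /= scalerA; congr (_ *: _); rewrite factS natrM.
by rewrite invfM mulrA mulfV ?mul1r ?pnatr_eq0.
Qed.

(** By induction after multiplying by [k.+1], which is split as [i + (k.+1 - i)] between the two
    factors. *)
Lemma dp_br k x y : dp k (br x y) = \sum_(i < k.+1) br (dp i x) (dp (k - i) y).
Proof.
elim: k => [|k IH]; first by rewrite big_ord1 /dp /= invr1 !scale1r.
apply: (@scalerI _ _ (k.+1)%:R); first by rewrite pnatr_eq0.
rewrite dpS IH [LHS]linear_sum scaler_sumr /=.
under [LHS]eq_bigr => i _ do rewrite derD -!dpS.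
have E (i : 'I_k.+2) : (k.+1)%:R *: br (dp i x) (dp (k.+1 - i) y) =
    br (i%:R *: dp i x) (dp (k.+1 - i) y) + br (dp i x) ((k.+1 - i)%:R *: dp (k.+1 - i) y).
  by rewrite brZl brZr -scalerDl -natrD subnKC // -ltnS.
under [RHS]eq_bigr => i _ do rewrite E.
rewrite !big_split /=; congr (_ + _).
  by rewrite [RHS]big_ord_recl scale0r br0l add0r; apply: eq_bigr => i _.
rewrite [RHS]big_ord_recr /= subnn scale0r br0r addr0; apply: eq_bigr => i _.
by rewrite subSn // -ltnS.
Qed.

Lemma iter_lin0 k : iter k D 0 = 0.
Proof. by elim: k => //= k ->; rewrite linear0. Qed.

Lemma dp_ge k x : (n <= k)%N -> dp k x = 0.
Proof.
by move=> nk; rewrite /dp -(subnK nk) iterD nilD iter_lin0 scaler0.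
Qed.

Lemma iter_linP k : linear (iter k D).
Proof. by move=> a x y; elim: k => //= k ->; rewrite linearP. Qed.

(** The bound is [n.+3] so that the terms of degree 0, 1 and 2 can be peeled off in [expD3] whatever
    [n] is; the terms from [n] on vanish. *)
Lemma expD_linear : linear (fun x => \sum_(i < n.+3) dp i x).
Proof.
move=> a x y; rewrite scaler_sumr -big_split; apply: eq_bigr => i _.
by rewrite /dp iter_linP scalerDr !scalerA mulrC.
Qed.
Definition expD_fun : {linear L -> L} := HB.pack (fun x => \sum_(i < n.+3) dp i x)
  (GRing.isLinear.Build R L L *:%R _ expD_linear).
Definition expD : 'End(L) := linfun expD_fun.

Lemma expDE m x : (n <= m)%N -> expD x = \sum_(i < m) dp i x.
Proof.
have H k : (n <= k)%N -> \sum_(i < k) dp i x = \sum_(i < n) dp i x.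
  move=> nk; rewrite -(subnKC nk) big_split_ord /= [X in _ + X]big1 ?addr0 // => i _.
  by rewrite dp_ge // leq_addr.
by move=> nm; rewrite lfunE /= H ?H // -addn3 leq_addr.
Qed.

Lemma triangle_sum (F : nat -> nat -> L) m :
  \sum_(k < m) \sum_(i < k.+1) F i (k - i)%N = \sum_(i < m) \sum_(j < m - i) F i j.
Proof.
under eq_bigr => k _ do rewrite (big_ord_widen m (fun i => F i (k - i)%N)) //.
rewrite (exchange_big_dep xpredT) //=; apply: eq_bigr => i _.
rewrite -(big_geq_mkord i m xpredT (fun k => F i (k - i)%N)) -[X in \sum_(X <= _ < _ | _) _]add0n big_addn.
by rewrite big_mkord; apply: eq_bigr => j _; rewrite addnK.
Qed.

(** Cutting at [n + n] leaves for each [i < n] an inner range of length at least [n], so the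
    triangular sum is the whole product. *)
Lemma expD_br x y : expD (br x y) = br (expD x) (expD y).
Proof.
rewrite (@expDE (n + n)) ?leq_addr //.
under eq_bigr => k _ do rewrite dp_br.
rewrite (triangle_sum (fun i j => br (dp i x) (dp j y))).
rewrite (@expDE (n + n) x) ?leq_addr // br_suml; apply: eq_bigr => i _.
have [ni|ni] := leqP n i.
  by rewrite dp_ge // br0l big1 // => j _; rewrite br0l.
by rewrite -br_sumr -expDE // -addnBA ?leq_addr // ltnW.
Qed.

(** The exponential commutes with [D], so by induction on the order of nilpotency at [x] one gets
    [D x = 0], and then [expD x = x]. *)
Lemma expD_inj x : expD x = 0 -> x = 0.
Proof.
move=> e; have := nilD x; move: e; elim: {1}n x => [//|k IH] x e.
rewrite iterSr => h; have D0 : D x = 0.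
  apply: IH => //; have : D (expD x) = 0 by rewrite e linear0.
  rewrite !(@expDE n) // => e0; rewrite -[RHS]e0 [RHS]linear_sum.
  by apply: eq_bigr => i _; rewrite /dp [RHS]linearZ /= -iterSr.
move: e; rewrite (@expDE n.+1) // big_ord_recl big1 => [|i _]; last first.
  by rewrite /dp lift0 iterSr D0 iter_lin0 scaler0.
by rewrite addr0 /dp /= invr1 scale1r.
Qed.

Lemma expD3 x : D (D (D x)) = 0 -> expD x = x + D x + 2^-1 *: D (D x).
Proof.
move=> h; rewrite lfunE /= !big_ord_recl big1 => [|i _].
  by rewrite /dp /= !fact0 invr1 !scale1r addr0 addrA.
by rewrite /dp !lift0 !iterSr h iter_lin0 scaler0.
Qed.

End Exponential.

Lemma lfun_inj_aut (f : 'End(L)) : (forall x, f x = 0 -> x = 0) ->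
  (forall x y, f (br x y) = br (f x) (f y)) -> automorphism br f.
Proof.
move=> inj mor; split=> //.
have k0 : lker f == 0%VS.
  by apply/lker0P => x y e; apply/eqP; rewrite -subr_eq0; apply/eqP/inj; rewrite linearB /= e subrr.
by exists (f^-1)%VF; [apply: lker0_lfunK|apply: lker0_lfunVK].
Qed.

Lemma aut_id : automorphism br \1%VF.
Proof. by split=> [|x y]; rewrite ?id_lfunE //; exists id => x; rewrite id_lfunE. Qed.

Lemma aut_comp f g : automorphism br f -> automorphism br g -> automorphism br (f \o g)%VF.
Proof.
move=> [bf hf] [bg hg]; split=> [|x y]; last by rewrite !comp_lfunE hg hf.
by apply: (eq_bij (bij_comp bf bg)) => x; rewrite /= comp_lfunE.
Qed.

Lemma exp_ad x : (exists n, forall y, iter n (br x) y = 0) ->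
  forall t : R, exists2 f : 'End(L), automorphism br f &
  forall y, br x (br x (br x y)) = 0 ->
    f y = y + t *: br x y + (t ^+ 2 / 2) *: br x (br x y).
Proof.
move=> [n nil] t; pose D := ad br (t *: x).
have DE y : D y = t *: br x y by rewrite adE brZl.
have iD k y : iter k D y = t ^+ k *: iter k (br x) y.
  elim: k => [|k IH] /=; first by rewrite scale1r.
  by rewrite IH DE brZr scalerA exprS.
have nD y : iter n D y = 0 by rewrite iD nil scaler0.
have dD y z : D (br y z) = br (D y) z + br y (D z).
  by rewrite !adE jacobi.
exists (expD D n); first exact: lfun_inj_aut (expD_inj nD) (expD_br dD nD).
move=> y h; rewrite expD3 => [|]; last by rewrite !DE !brZr h !scaler0.
by rewrite !DE brZr !scalerA; congr (_ + _ *: _); field.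
Qed.

End LieAlgebra.

(** * Integer gradings and the involution of a grading element *)

Lemma free_subseq (R : realType) (T : vectType R) (P : T -> Prop) (s : seq T) :
  (forall x, x \in s -> P x) ->
  exists s' : seq T, [/\ forall x, x \in s' -> P x, free s' & <<s'>>%VS = <<s>>%VS].
Proof.
elim: s => [|x s IH] hs; first by exists [::]; split=> //; rewrite nil_free.
have [|s' [ps fs es]] := IH; first by move=> y ys; apply: hs; rewrite in_cons ys orbT.
have [xs|xs] := boolP (x \in <<s>>%VS).
  exists s'; split=> //; rewrite es span_cons; apply/esym/addv_idPr.
  by rewrite -memvE.
exists (x :: s'); split; last by rewrite !span_cons es.
  by move=> y; rewrite in_cons => /predU1P[->|/ps//]; apply: hs; rewrite mem_head.
by rewrite free_cons es xs.
Qed.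

Lemma basis_of_spanning (R : realType) (L : vectType R) (P : L -> Prop) :
  (forall U : {vspace L}, (forall x, P x -> x \in U) -> U = fullv) ->
  exists2 e : (\dim {:L}).-tuple L, basis_of {:L} e & forall x, x \in e -> P x.
Proof.
move=> sp.
have [s ps full] : exists2 s : seq L, forall x, x \in s -> P x & <<s>>%VS = fullv.
  suff H k (s : seq L) : (forall x, x \in s -> P x) -> (\dim {:L} - \dim <<s>> < k)%N ->
      exists2 s : seq L, forall x, x \in s -> P x & <<s>>%VS = fullv.
    by apply: (H (\dim {:L}).+1 [::]) => //; rewrite ltnS leq_subr.
  elim: k s => // k IH s ps hk.
  have [e|ne] := eqVneq <<s>>%VS fullv; first by exists s.
  have [x px xs] : exists2 x, P x & x \notin <<s>>%VS.
    apply: contrapT => n; case/eqP: ne; apply: sp => x px.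
    by apply: contrapT => /negP nx; apply: n; exists x.
  apply: (IH (x :: s)); first by move=> y; rewrite in_cons => /predU1P[->|/ps].
  have lt : (\dim <<s>> < \dim <<x :: s>>)%N.
    rewrite span_cons ltn_neqAle dimvS ?addvSr // andbT; apply: contra xs => /eqP e.
    have -> : <<s>>%VS = (<[x]> + <<s>>)%VS by apply/eqP; rewrite eqEdim addvSr e leqnn.
    by rewrite (subvP (addvSl _ _)) // memv_line.
  rewrite ltnS in hk; apply: leq_trans hk; apply: ltn_sub2l => //.
  by apply: leq_trans lt _; rewrite dimvS ?subvf.
have [e [pe fe se]] := free_subseq ps.
have be : basis_of {:L} e by rewrite /basis_of se full eqxx.
have sz : size e == \dim {:L} by rewrite -full -se eq_sym.
by exists (Tuple sz).
Qed.

Section Grading.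
Variables (R : realType) (L : vectType R) (br : L -> L -> L).
Hypothesis lieL : lie_algebra br.

Definition eigz E x (m : int) := br E x = m%:~R *: x.
(** Diagonalizability of [ad E] over the integers, stated as a spanning property: it transports
    along automorphisms, and applied to kernels it reduces operator identities to eigenvectors. *)
Definition intdiag E := forall U : {vspace L},
  (forall x, (exists m, eigz E x m) -> x \in U) -> U = fullv.

Lemma intdiag_aut f E : automorphism br f -> intdiag E -> intdiag (f E).
Proof.
move=> [[g _ gk] fm] dE U hU; apply/eqP; rewrite eqEsubv subvf; apply/subvP => y _.
have : g y \in (f @^-1: U)%VS.
  rewrite (dE (f @^-1: U)%VS) ?memvf // => x [m hm]; rewrite -memv_preim.
  by apply: hU; exists m; rewrite /eigz -fm hm linearZ.
by rewrite -memv_preim gk.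
Qed.

Lemma lfunZ (f : 'End(L)) c x : f (c *: x) = c *: f x.
Proof. exact: linearZ. Qed.

Lemma add_sub_eq (a b p : L) : a + b = p -> a - b = p -> a = p.
Proof.
move=> <- e; have /eqP : b + b = 0 by rewrite -{1}(addKr a b) -e addrA addNr add0r addNr.
by rewrite -mulr2n -scaler_nat scaler_eq0 pnatr_eq0 => /eqP->; rewrite addr0.
Qed.

Section Operators.
Variable E : L.
Hypothesis dE : intdiag E.

(** Functional calculus: [T] is [c (ad E)], defined on an eigenbasis. An arbitrary eigenvector for
    [m] has coordinates only along basis vectors of eigenvalue [m]. *)
Lemma grading_op (c : int -> R) :
  exists T : 'End(L), forall x m, eigz E x m -> T x = c m *: x.
Proof.
have [e be we] := basis_of_spanning dE.
have eig (i : 'I_(\dim {:L})) : exists m, eigz E e`_i m.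
  by apply: we; rewrite mem_nth ?size_tuple.
have [w hw] := fin_all_exists eig.
pose F x := \sum_i (coord e i x * c (w i)) *: e`_i.
have linF : linear F.
  move=> a x y; rewrite scaler_sumr -big_split; apply: eq_bigr => i _ /=.
  by rewrite linearP /= mulrDl scalerDl scalerA mulrA.
pose Fl : {linear L -> L} := HB.pack F (GRing.isLinear.Build R L L *:%R F linF).
exists (linfun Fl) => x m hx; rewrite lfunE /= /F.
rewrite [x in RHS](coord_basis be (memvf x)) scaler_sumr; apply: eq_bigr => i _.
have : coord e i x * ((w i)%:~R - m%:~R) = 0.
  have := congr1 (coord e i) hx; rewrite linearZ /= {1}(coord_basis be (memvf x)).
  rewrite (br_sumr lieL) linear_sum (bigD1 i) //= big1 ?addr0 => [|j ji].
    rewrite (brZr lieL) hw !linearZ /= coord_free ?(basis_free be) // eqxx.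
    by rewrite mulr1 mulrBr => ->; rewrite mulrC subrr.
  rewrite (brZr lieL) hw !linearZ /= coord_free ?(basis_free be) //.
  by rewrite (negPf ji) !mulr0.
move/eqP; rewrite mulf_eq0 => /orP[/eqP->|]; first by rewrite mul0r !scale0r scaler0.
by rewrite subr_eq0 eqr_int => /eqP->; rewrite scalerA mulrC.
Qed.

Lemma eig_ext (A C : 'End(L)) : (forall x m, eigz E x m -> A x = C x) -> A = C.
Proof.
move=> e; apply/lfunP => x; have : x \in lker (A - C).
  rewrite (dE (U := lker (A - C))) ?memvf // => y [m hy].
  by rewrite memv_ker add_lfunE opp_lfunE (e _ _ hy) subrr.
by rewrite memv_ker add_lfunE opp_lfunE subr_eq0 => /eqP.
Qed.

(** Identities involving the bracket are checked on pairs of eigenvectors; skew-symmetry makes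
    linearity in the second argument serve for both. *)
Lemma eig_bilinear (A : L -> 'End(L)) : (forall x y, A x y = - A y x) ->
  (forall x y m k, eigz E x m -> eigz E y k -> A x y = 0) -> forall x y, A x y = 0.
Proof.
move=> an z x y; suff -> : A x = 0 by rewrite zero_lfunE.
apply: eig_ext => {}y k hy; rewrite zero_lfunE an.
suff -> : A y = 0 by rewrite zero_lfunE oppr0.
by apply: eig_ext => {}x m hx; rewrite zero_lfunE (z _ _ _ _ hy hx).
Qed.

Lemma eigz_br x y m k : eigz E x m -> eigz E y k -> eigz E (br x y) (m + k).
Proof.
move=> hx hy; rewrite /eigz (jacobi lieL) hx hy (brZl lieL) (brZr lieL) -scalerDl.
by rewrite rmorphD.
Qed.

(** [sgz2 m] is (-1)^m; [rei m] and [imi m] are the real and imaginary parts of i^m. *)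
Definition sgz2 (m : int) : R := if (m %% 2)%Z == 0 then 1 else -1.
Definition rei (m : int) : R :=
  if (m %% 4)%Z == 0 then 1 else if (m %% 4)%Z == 2 then -1 else 0.
Definition imi (m : int) : R :=
  if (m %% 4)%Z == 1 then 1 else if (m %% 4)%Z == 3 then -1 else 0.

Lemma mod4_cases (m : int) : [\/ (m %% 4)%Z = 0, (m %% 4)%Z = 1, (m %% 4)%Z = 2 | (m %% 4)%Z = 3].
Proof.
have h : (m %% 4)%Z = 0 \/ (m %% 4)%Z = 1 \/ (m %% 4)%Z = 2 \/ (m %% 4)%Z = 3 by lia.
by case: h => [|[|[|]]] h; [apply: Or41|apply: Or42|apply: Or43|apply: Or44].
Qed.

Lemma sgz2E (m : int) : sgz2 m = rei m ^+ 2 - imi m ^+ 2.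
Proof.
rewrite /sgz2 /rei /imi; have [e|e|e|e] := mod4_cases m; rewrite e /=.
- by rewrite (_ : (m %% 2)%Z = 0) /=; [ring|lia].
- by rewrite (_ : (m %% 2)%Z = 1) /=; [ring|lia].
- by rewrite (_ : (m %% 2)%Z = 0) /=; [ring|lia].
- by rewrite (_ : (m %% 2)%Z = 1) /=; [ring|lia].
Qed.

Lemma rei_imi (m : int) : rei m ^+ 2 + imi m ^+ 2 = 1 /\ rei m * imi m = 0.
Proof.
by rewrite /rei /imi; have [e|e|e|e] := mod4_cases m; rewrite e /=; split; ring.
Qed.

Lemma reiD (m k : int) : rei (m + k) = rei m * rei k - imi m * imi k /\
  imi (m + k) = rei m * imi k + imi m * rei k.
Proof.
rewrite /rei /imi -modzDm.
have [e|e|e|e] := mod4_cases m; have [e'|e'|e'|e'] := mod4_cases k;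
  by rewrite e e' /=; split; ring.
Qed.

Lemma sgz2D (m k : int) : sgz2 (m + k) = sgz2 m * sgz2 k.
Proof.
have [h1 h2] := reiD m k; have [_ z1] := rei_imi m; have [_ z2] := rei_imi k.
rewrite !sgz2E h1 h2.
rewrite (_ : _ - _ = (rei m ^+ 2 - imi m ^+ 2) * (rei k ^+ 2 - imi k ^+ 2)
   - 4 * ((rei m * imi m) * (rei k * imi k))); last by ring.
by rewrite z1 z2; ring.
Qed.

Lemma sgz2_sqr m : sgz2 m * sgz2 m = 1.
Proof. by rewrite /sgz2; case: eqP => _; ring. Qed.

(* sigma = (-1)^(ad E), and the isomorphism onto its real form is i^(ad E) *)
Lemma grading_involution : exists sigma : 'End(L),
  [/\ automorphism br sigma, forall x, sigma (sigma x) = x, iso_to_split br sigma &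
      forall x m, eigz E x m -> sigma x = sgz2 m *: x].
Proof.
have [sg hs] := grading_op sgz2; have [f1 h1] := grading_op rei.
have [f2 h2] := grading_op imi.
have invs x : sg (sg x) = x.
  have e : (sg \o sg)%VF = \1%VF.
    apply: eig_ext => {}x m hx.
    by rewrite comp_lfunE id_lfunE (hs _ _ hx) lfunZ (hs _ _ hx) scalerA sgz2_sqr scale1r.
  by rewrite -comp_lfunE e id_lfunE.
(* With i^m = a + ib, this identity and the next three are a^2 + b^2 = 1, a^2 - b^2 = (-1)^m and ab
   = 0 in both orders. *)
have pyth x : f1 (f1 x) + f2 (f2 x) = x.
  have e : ((f1 \o f1) + (f2 \o f2))%VF = \1%VF.
    apply: eig_ext => {}x m hx; rewrite add_lfunE !comp_lfunE id_lfunE (h1 _ _ hx) (h2 _ _ hx).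
    rewrite !lfunZ (h1 _ _ hx) (h2 _ _ hx) !scalerA -scalerDl -!expr2.
    by have [-> _] := rei_imi m; rewrite scale1r.
  by rewrite -comp_lfunE -(comp_lfunE f2) -add_lfunE e id_lfunE.
have diff x : f1 (f1 x) - f2 (f2 x) = sg x.
  have e : ((f1 \o f1) - (f2 \o f2))%VF = sg.
    apply: eig_ext => {}x m hx; rewrite add_lfunE opp_lfunE !comp_lfunE (h1 _ _ hx) (h2 _ _ hx).
    rewrite !lfunZ (h1 _ _ hx) (h2 _ _ hx) (hs _ _ hx) !scalerA -scalerBl -!expr2.
    by rewrite sgz2E.
  by rewrite -e add_lfunE opp_lfunE !comp_lfunE.
have z12 x : f1 (f2 x) = 0.
  have e : (f1 \o f2)%VF = 0.
    apply: eig_ext => {}x m hx; rewrite comp_lfunE zero_lfunE (h2 _ _ hx) lfunZ.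
    by rewrite (h1 _ _ hx) scalerA mulrC; have [_ ->] := rei_imi m; rewrite scale0r.
  by rewrite -comp_lfunE e zero_lfunE.
have z21 x : f2 (f1 x) = 0.
  have e : (f2 \o f1)%VF = 0.
    apply: eig_ext => {}x m hx; rewrite comp_lfunE zero_lfunE (h1 _ _ hx) lfunZ.
    by rewrite (h2 _ _ hx) scalerA; have [_ ->] := rei_imi m; rewrite scale0r.
  by rewrite -comp_lfunE e zero_lfunE.
exists sg; split=> //.
- split; first by exists sg.
  move=> x y; apply/eqP; rewrite -subr_eq0; apply/eqP.
  pose A x := ((sg \o ad br x) - (ad br (sg x) \o sg))%VF.
  have AE u v : A u v = sg (br u v) - br (sg u) (sg v).
    by rewrite add_lfunE opp_lfunE !comp_lfunE !(adE lieL).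
  rewrite -AE; apply: eig_bilinear => [u v|u v m k hu hv]; rewrite !AE.
    by rewrite (br_anti lieL u v) (br_anti lieL (sg u)) linearN opprB opprK addrC.
  rewrite (hs _ _ (eigz_br hu hv)) (hs _ _ hu) (hs _ _ hv) (brZl lieL) (brZr lieL).
  by rewrite scalerA -scalerBl sgz2D subrr scale0r.
- exists f1, f2; split.
  + by move=> x y [e1 e2]; rewrite -(pyth x) e1 e2 pyth.
  + move=> x; split=> /=; rewrite -diff.
      by rewrite z21 linear0 subr0 -[RHS]pyth z21 linear0 addr0.
    by rewrite z12 linear0 sub0r -[in RHS](pyth (f2 x)) z12 linear0 add0r.
  (* The witness is the real part of i^(- ad E) applied to p + iq. *)
  + move=> [p q] [/= hp hq]; exists (f1 p + f2 q).
    have ep : f1 (f1 p) = p by apply: add_sub_eq (pyth p) _; rewrite diff.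
    have eq : f2 (f2 q) = q.
      apply: (@add_sub_eq _ (f1 (f1 q))); first by rewrite addrC pyth.
      by rewrite -opprB diff hq opprK.
    by rewrite !linearD /= ep eq z12 z21 addr0 add0r.
  + move=> x y; rewrite /brC /=; congr (_, _); apply/eqP; rewrite -subr_eq0; apply/eqP.
      pose A x := ((f1 \o ad br x) - ((ad br (f1 x) \o f1) - (ad br (f2 x) \o f2)))%VF.
      have AE u v : A u v = f1 (br u v) - (br (f1 u) (f1 v) - br (f2 u) (f2 v)).
        by rewrite !(add_lfunE, opp_lfunE, comp_lfunE) !(adE lieL).
      rewrite -AE; apply: eig_bilinear => [u v|u v m k hu hv]; rewrite !AE.
        rewrite (br_anti lieL u v) (br_anti lieL (f1 u)) (br_anti lieL (f2 u)) linearN /= !opprD !opprK.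
        by [].
      rewrite (h1 _ _ (eigz_br hu hv)) (h1 _ _ hu) (h1 _ _ hv) (h2 _ _ hu) (h2 _ _ hv).
      rewrite !(brZl lieL) !(brZr lieL) !scalerA -!scalerBl; have [-> _] := reiD m k.
      by rewrite subrr scale0r.
    pose A x := ((f2 \o ad br x) - ((ad br (f1 x) \o f2) + (ad br (f2 x) \o f1)))%VF.
    have AE u v : A u v = f2 (br u v) - (br (f1 u) (f2 v) + br (f2 u) (f1 v)).
      by rewrite !(add_lfunE, opp_lfunE, comp_lfunE) !(adE lieL).
    rewrite -AE; apply: eig_bilinear => [u v|u v m k hu hv]; rewrite !AE.
      rewrite (br_anti lieL u v) (br_anti lieL (f1 u)) (br_anti lieL (f2 u)) linearN /= !opprD !opprK.
      by rewrite (addrC (br _ (f2 u))).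
    rewrite (h2 _ _ (eigz_br hu hv)) (h1 _ _ hu) (h1 _ _ hv) (h2 _ _ hu) (h2 _ _ hv).
    rewrite !(brZl lieL) !(brZr lieL) !scalerA -!scalerDl -scalerBl; have [_ ->] := reiD m k.
    by rewrite subrr scale0r.
Qed.

End Operators.
End Grading.

(** * Weights and root spaces of a Chevalley system *)

Section Chevalley.
Variables (R : realType) (L : vectType R) (br : L -> L -> L).
Variables (h : {vspace L}) (X Hc : functional h -> L) (tau : 'End(L)).
Hypothesis lieL : lie_algebra br.
Hypothesis ssL : semisimple br.
Hypothesis cartanh : cartan br h.
Hypothesis chev : chevalley br X Hc tau.
Local Notation root := (@is_root R L br h).
Local Notation rsp := (@root_space R L br h).

Lemma evD (a b : functional h) H : ev (a + b) H = ev a H + ev b H.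
Proof. by rewrite /ev add_lfunE. Qed.
Lemma evN (a : functional h) H : ev (- a) H = - ev a H.
Proof. by rewrite /ev opp_lfunE. Qed.
Lemma evB (a b : functional h) H : ev (a - b) H = ev a H - ev b H.
Proof. by rewrite evD evN. Qed.
Lemma evZ c (a : functional h) H : ev (c *: a) H = c * ev a H.
Proof. by rewrite /ev scale_lfunE. Qed.
Lemma ev0 H : ev (0 : functional h) H = 0.
Proof. by rewrite /ev zero_lfunE. Qed.
Lemma ev_suml I (s : seq I) (P : pred I) (F : I -> functional h) H :
  ev (\sum_(i <- s | P i) F i) H = \sum_(i <- s | P i) ev (F i) H.
Proof. by rewrite /ev sum_lfunE. Qed.
Lemma ev_linear (a : functional h) : linear (ev a : L -> R^o).
Proof. by move=> c x y; rewrite /ev !linearP. Qed.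
Definition evl (a : functional h) : {linear L -> R^o} := HB.pack (ev a : L -> R^o)
  (GRing.isLinear.Build R L R^o *:%R (ev a : L -> R^o) (ev_linear a)).
Lemma evBr (a : functional h) x y : ev a (x - y) = ev a x - ev a y.
Proof. exact: (linearB (evl a)). Qed.
Lemma evZr (a : functional h) c x : ev a (c *: x) = c * ev a x.
Proof. exact: (linearZ_LR (evl a)). Qed.
Lemma ev_sumr (a : functional h) I (s : seq I) (P : pred I) (F : I -> L) :
  ev a (\sum_(i <- s | P i) F i) = \sum_(i <- s | P i) ev a (F i).
Proof. exact: (linear_sum (evl a)). Qed.
Lemma ev_inj (a b : functional h) : (forall H, H \in h -> ev a H = ev b H) -> a = b.
Proof.
move=> e; apply/lfunP => x; have := e (vsval x) (subvsP x).
by rewrite /ev vsvalK.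
Qed.
Lemma ev_neq (a b : functional h) : a != b -> exists2 H, H \in h & ev a H != ev b H.
Proof.
move=> ab; apply: contrapT => n; case/eqP: ab; apply: ev_inj => H hH.
by apply/eqP; apply: contrapT => /negP ne; apply: n; exists H.
Qed.

(** [tau] sends [br H H'] to its opposite because it lies in [h], and to itself because both
    arguments change sign. *)
Lemma br_hh H H' : H \in h -> H' \in h -> br H H' = 0.
Proof.
have [_ _ _ _ [[_ tm] _ th _]] := chev; have [sub _ _] := cartanh.
move=> hH hH'; have := th _ (sub _ _ hH hH').
rewrite tm !th // (brNl lieL) (brNr lieL) opprK => /eqP.
by rewrite -addr_eq0 -mulr2n -scaler_nat scaler_eq0 pnatr_eq0 => /eqP.
Qed.
Lemma rsp_h H : H \in h -> rsp (0 : functional h) H.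
Proof. by move=> hH H' hH'; rewrite br_hh // ev0 scale0r. Qed.
Lemma rsp_br (a b : functional h) x y : rsp a x -> rsp b y -> rsp (a + b) (br x y).
Proof.
move=> hx hy H hH; rewrite (jacobi lieL) (hx H hH) (hy H hH) (brZl lieL) (brZr lieL) -scalerDl.
by rewrite evD.
Qed.
Lemma rspX a : root a -> rsp a (X a).
Proof. by have [[h1 _] _ _ _ _] := chev => /h1[]. Qed.
Lemma X_neq0 a : root a -> X a != 0.
Proof. by have [[h1 _] _ _ _ _] := chev => /h1[]. Qed.
Lemma Hc_h a : root a -> Hc a \in h.
Proof. by have [[_ h1] _ _ _ _] := chev; apply: h1. Qed.
Lemma ev_Hc_int (a b : functional h) : root a -> root b -> exists z : int, ev a (Hc b) = z%:~R.
Proof. by have [_ h1 _ _ _] := chev; apply: h1. Qed.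
Lemma br_XX a : root a -> br (X a) (X (- a)) = - Hc a.
Proof. by have [_ _ h1 _ _] := chev; apply: h1. Qed.
Lemma ev_Hc a : root a -> ev a (Hc a) = 2.
Proof.
move=> ra; have [_ _ _ [h1 _] _] := chev; have [e _] := h1 a ra.
move: e; rewrite rspX ?Hc_h // => /eqP; rewrite -subr_eq0 -scalerBl scaler_eq0.
by rewrite (negPf (X_neq0 ra)) orbF subr_eq0 => /eqP.
Qed.
Lemma tau_h H : H \in h -> tau H = - H.
Proof. by have [_ _ _ _ [_ _ h1 _]] := chev; apply: h1. Qed.
Lemma tau_br x y : tau (br x y) = br (tau x) (tau y).
Proof. by have [_ _ _ _ [[_ h1] _ _ _]] := chev; apply: h1. Qed.
Lemma tauK x : tau (tau x) = x.
Proof. by have [_ _ _ _ [_ h1 _ _]] := chev; apply: h1. Qed.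
Lemma tau_X a : root a -> tau (X a) = X (- a).
Proof. by have [_ _ _ _ [_ _ _ h1]] := chev; apply: h1. Qed.
Lemma rootN a : root a -> root (- a).
Proof.
move=> [a0 [x [x0 hx]]]; split; first by rewrite oppr_eq0.
exists (tau x); split.
  by apply: contra_neq x0 => e; rewrite -(tauK x) e linear0.
move=> H hH; rewrite -[in LHS](tauK H) -tau_br (tau_h hH) (brNl lieL) (hx H hH).
by rewrite evN scaleNr linearN linearZ.
Qed.
Lemma root_neq0 a : root a -> a != 0.
Proof. by case. Qed.

(** [is_root] is a mere proposition on functionals. A finite list of roots is extracted from the
    spanning property by increasing dimension; that it contains every root is shown afterwards, in
    [rootsP]. *)
Lemma exists_roots : exists rs : seq (functional h),
  (forall a, a \in rs -> root a) /\
  forall U : {vspace L}, (h <= U)%VS -> (forall a, a \in rs -> X a \in U) -> U = fullv.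
Proof.
have [_ _ _ [_ sp] _] := chev.
suff H k (U0 : {vspace L}) : (\dim {:L} - \dim U0 < k)%N -> (h <= U0)%VS ->
    exists rs : seq (functional h), (forall a, a \in rs -> root a) /\
  forall U : {vspace L}, (U0 <= U)%VS -> (forall a, a \in rs -> X a \in U) -> U = fullv.
  exact: (H _ _ (ltnSn _) (subvv h)).
elim: k U0 => // k IH U0 hk hU0.
have [e|ne] := eqVneq U0 fullv.
  exists [::]; split=> // U; rewrite e => hU _; apply/eqP.
  by rewrite eqEsubv subvf hU.
have [a ra hXa] : exists2 a, root a & X a \notin U0.
  apply: contrapT => n; case/eqP: ne; apply: sp => // a ra.
  by apply: contrapT => /negP nX; apply: n; exists a.
have [||rs [rr rsp]] := IH (U0 + <[X a]>)%VS.
- have lt : (\dim U0 < \dim (U0 + <[X a]>))%N.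
    rewrite ltn_neqAle dimvS ?addvSl // andbT; apply: contra hXa => /eqP e.
    have -> : U0 = (U0 + <[X a]>)%VS by apply/eqP; rewrite eqEdim addvSl e leqnn.
    by rewrite (subvP (addvSr _ _)) // memv_line.
  rewrite ltnS in hk; apply: leq_trans hk; apply: ltn_sub2l => //.
  by apply: leq_trans lt _; rewrite dimvS ?subvf.
- exact: subv_trans hU0 (addvSl _ _).
exists (a :: rs); split=> [b|U hU hX]; first by rewrite in_cons => /predU1P[->|/rr].
apply: rsp => [|b bs]; last by rewrite hX // in_cons bs orbT.
by rewrite subv_add hU -memvE hX // mem_head.
Qed.

Definition roots0 : seq (functional h) := projT1 (cid exists_roots).
Definition roots := undup roots0.
Lemma roots0P : (forall a, a \in roots0 -> root a) /\
  forall U : {vspace L}, (h <= U)%VS -> (forall a, a \in roots0 -> X a \in U) -> U = fullv.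
Proof. exact: projT2 (cid exists_roots). Qed.
Lemma roots_root a : a \in roots -> root a.
Proof. by rewrite mem_undup; have [h1 _] := roots0P; apply: h1. Qed.
Lemma roots_span (U : {vspace L}) :
  (h <= U)%VS -> (forall a, a \in roots -> X a \in U) -> U = fullv.
Proof.
have [_ h1] := roots0P => hU hX; apply: h1 => // a; rewrite -mem_undup; exact: hX.
Qed.

(** [T] is a product of operators [ad H - ev b H], one for each [b] in [bs], with [H] chosen to
    separate [a] from [b]. It serves as a projection onto the weight space of [a], up to a
    scalar. *)
Lemma weight_filter a (bs : seq (functional h)) : a \notin bs ->
  exists T : 'End(L), [/\ forall b y, b \in bs -> rsp b y -> T y = 0,
    forall b, exists c, forall y, rsp b y -> T y = c *: y &
    exists2 c, c != 0 & forall y, rsp a y -> T y = c *: y].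
Proof.
elim: bs => [|b bs IH].
  move=> _; exists \1%VF; split=> // [b|]; exists 1; rewrite ?oner_neq0 // => y _; by rewrite id_lfunE scale1r.
rewrite in_cons negb_or => /andP[ab /IH[T [T0 Tc [c c0 Ta]]]].
have [H hH ne] := ev_neq ab.
pose T' := ((ad br H - ev b H *: \1) \o T)%VF.
have T'E d y k : rsp d y -> T y = k *: y -> T' y = ((ev d H - ev b H) * k) *: y.
  move=> hy e; rewrite /T' comp_lfunE e linearZ /= add_lfunE opp_lfunE scale_lfunE.
  by rewrite id_lfunE (adE lieL) hy // -scalerBl scalerA mulrC.
exists T'; split.
- move=> d y; rewrite in_cons => /predU1P[->|dbs] hy.
    have [k hk] := Tc b; rewrite (T'E b y k) ?subrr ?mul0r ?scale0r //; exact: hk.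
  by rewrite (T'E d y 0) ?mulr0 ?scale0r // (T0 _ _ dbs hy).
- move=> d; have [k hk] := Tc d; exists ((ev d H - ev b H) * k) => y hy.
  by apply: T'E => //; apply: hk.
- exists ((ev a H - ev b H) * c); first by rewrite mulf_neq0 // subr_eq0.
  by move=> y hy; apply: T'E => //; apply: Ta.
Qed.

(** The filter for [a] against [0 :: roots] kills [h] and every listed [X b], hence is zero, while
    it multiplies [x] by a non-zero scalar. *)
Lemma rsp_eq0 (a : functional h) x : a != 0 -> a \notin roots -> rsp a x -> x = 0.
Proof.
move=> a0 ar hx; have [|T [T0 _ [c c0 Ta]]] := @weight_filter a (0 :: roots).
  by rewrite in_cons negb_or a0.
have : x \in lker T.
  rewrite (@roots_span (lker T)) ?memvf //.
    by apply/subvP => H /rsp_h hH; rewrite memv_ker (T0 0) ?mem_head.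
  move=> b rb; rewrite memv_ker (T0 b) ?in_cons ?rb ?orbT //.
  exact/rspX/roots_root.
by rewrite memv_ker Ta // scaler_eq0 (negPf c0) => /eqP.
Qed.

Lemma rootsP a : reflect (root a) (a \in roots).
Proof.
apply: (iffP idP) => [|[a0 [x [x0 hx]]]]; first exact: roots_root.
by apply: contraT => n; rewrite (rsp_eq0 a0 n hx) eqxx in x0.
Qed.

(** The filter for [a] against the other weights maps everything into the line of [X a], and is a
    non-zero scalar on the weight space of [a]. *)
Lemma rsp_line a x : root a -> rsp a x -> x \in <[X a]>%VS.
Proof.
move=> ra hx; have [|T [T0 _ [c c0 Ta]]] := @weight_filter a (rem a (0 :: roots)).
  by rewrite mem_rem_uniq ?inE ?eqxx //= undup_uniq andbT; apply/rootsP => -[]; rewrite eqxx.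
have : x \in (T @^-1: <[X a]>)%VS.
  rewrite (@roots_span (T @^-1: <[X a]>)) ?memvf //.
    apply/subvP => H /rsp_h hH; rewrite -memv_preim (T0 0) ?mem0v //.
    rewrite mem_rem_uniq ?inE ?eqxx /=; last by rewrite undup_uniq andbT; apply/rootsP => -[]; rewrite eqxx.
    by rewrite andbT eq_sym; case: ra.
  move=> b rb; have hb := rspX (roots_root rb).
  rewrite -memv_preim; have [->|ne] := eqVneq b a.
    by rewrite (Ta _ (rspX ra)) memvZ ?memv_line.
  rewrite (T0 b) ?mem0v // mem_rem_uniq ?inE ?ne ?rb ?orbT //=.
  by rewrite undup_uniq andbT; apply/rootsP => -[]; rewrite eqxx.
rewrite -memv_preim Ta // => /(memvZ c^-1).
by rewrite scalerA mulVf // scale1r.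
Qed.

Lemma rsp_iter (a b : functional h) x y k : rsp a x -> rsp b y ->
  rsp (b + k%:R *: a) (iter k (br x) y).
Proof.
move=> hx hy; elim: k => [|k IH] /=; first by rewrite scale0r addr0.
have := rsp_br hx IH; congr (rsp _ _).
by rewrite addrCA -natr1 scalerDl scale1r (addrC a).
Qed.

Lemma adX_nil a : root a -> exists n, forall y, iter n (br (X a)) y = 0.
Proof.
(* One more than the length of [0 :: roots]: among the [n] distinct functionals [b + k%:R *: a] with
   [k < n], one is outside this list. *)
move=> ra; pose n := (size roots).+2; exists n.
pose T := iter n (fun f => (ad br (X a) \o f)%VF) \1%VF.
have TE y : T y = iter n (br (X a)) y.
  rewrite /T; elim: (n) => [|k IH] /=; first by rewrite id_lfunE.
  by rewrite comp_lfunE IH (adE lieL).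
have kill (b : functional h) y : rsp b y -> y \in lker T.
  move=> hy; rewrite memv_ker TE.
  have [k kn out] : exists2 k, (k < n)%N & b + k%:R *: a \notin 0 :: roots.
    apply: contrapT => no.
    have : (size [seq (b + k%:R *: a)%R | k <- iota 0 n] <= size (0%R :: roots))%N.
      apply: uniq_leq_size.
        rewrite map_inj_uniq ?iota_uniq // => i j /addrI/eqP.
        rewrite -subr_eq0 -scalerBl scaler_eq0 (negPf (root_neq0 ra)) orbF.
        by rewrite subr_eq0 eqr_nat => /eqP.
      move=> c /mapP[k]; rewrite mem_iota add0n => kn ->.
      by apply: contrapT => /negP out; apply: no; exists k.
    by rewrite size_map size_iota /n /= ltnn.
  move: out; rewrite in_cons negb_or => /andP[n0 nr].
  have e := rsp_eq0 n0 nr (rsp_iter k (rspX ra) hy).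
  rewrite -(subnK (ltnW kn)) iterD e; apply/eqP.
  by elim: (n - k)%N => //= m ->; rewrite (br0r lieL).
move=> y; rewrite -TE; apply/eqP; rewrite -memv_ker.
rewrite (@roots_span (lker T)) ?memvf //.
  by apply/subvP => H /rsp_h; apply: kill.
by move=> b /roots_root/rspX; apply: kill.
Qed.

(** * Automorphisms attached to a root, and the root system axioms *)

Lemma Hc_opp a : root a -> Hc (- a) = - Hc a.
Proof.
move=> ra; have := br_XX (rootN ra).
by rewrite opprK (br_anti lieL) br_XX // opprK => ->; rewrite opprK.
Qed.

Lemma br_Xh a H : root a -> H \in h -> br (X a) H = - (ev a H *: X a).
Proof. by move=> ra hH; rewrite (br_anti lieL) (rspX ra). Qed.

Lemma expX a (t : R) : root a -> exists2 f : 'End(L), automorphism br f &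
  [/\ forall H, H \in h -> f H = H - (t * ev a H) *: X a,
      forall y, br (X a) y = 0 -> f y = y &
      f (X (- a)) = X (- a) - t *: Hc a + t ^+ 2 *: X a].
Proof.
move=> ra; have [f af fE] := (exp_ad lieL) _ (adX_nil ra) t.
exists f => //; split.
- move=> H hH; have e : br (X a) (br (X a) H) = 0.
    by rewrite (br_Xh ra hH) (brNr lieL) (brZr lieL) (brxx lieL) scaler0 oppr0.
  by rewrite fE e ?(br0r lieL) // scaler0 addr0 (br_Xh ra hH) scalerN scalerA.
- by move=> y e; rewrite fE e ?(br0r lieL) // !scaler0 !addr0.
- have e2 : br (X a) (- Hc a) = 2 *: X a.
    by rewrite (brNr lieL) br_Xh ?Hc_h // ev_Hc // opprK.
  rewrite fE br_XX // e2; first by rewrite scalerN scalerA divfK // pnatr_eq0.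
  by rewrite (brZr lieL) (brxx lieL) scaler0.
Qed.

(** The SL_2 representative exp(e) exp(-f) exp(e) of the reflection. Since [X_a, X_{-a}] = - H_a,
    the triple has f = - X_{-a}, so all three parameters are 1. *)
Lemma refl_aut a : root a -> exists2 f : 'End(L), automorphism br f &
  forall H, H \in h -> f H = H - ev a H *: Hc a.
Proof.
move=> ra; have rn := rootN ra.
have [f af [fh f0 fX]] := expX 1 ra.
have [g ag [gh g0 gX]] := expX 1 rn.
exists (f \o (g \o f))%VF; first by do !apply: (aut_comp (br := br)).
move=> H hH; rewrite !comp_lfunE (fh _ hH) [g _]linearB /= [g (_ *: _)]linearZ /= (gh _ hH).
move: gX; rewrite opprK Hc_opp // => ->; rewrite evN expr1n !scale1r !mul1r scaleNr !opprK.
have -> : H + ev a H *: X (- a) - ev a H *: (X a + Hc a + X (- a)) =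
    (H - ev a H *: Hc a) - ev a H *: X a.
  rewrite !scalerDr !opprD !addrA [LHS](AC 5 (1*4*3*2*5)) /= -addrA subrr addr0.
  by [].
rewrite [f _]linearB /= [f (_ *: _)]linearZ /=.
rewrite (fh (H - ev a H *: Hc a)) ?rpredB ?rpredZ ?Hc_h //.
rewrite (f0 (X a)) ?(brxx lieL) // evBr evZr ev_Hc // mul1r.
rewrite (_ : ev a H - ev a H * 2 = - ev a H); last by ring.
by rewrite scaleNr opprK addrK.
Qed.

(** The automorphism of [refl_aut] is an involution on [h], so it carries [X b] to a vector of the
    reflected weight. *)
Lemma root_rfl a b : root a -> root b -> root (b - ev b (Hc a) *: a).
Proof.
move=> ra rb; have [f [bf fm] fh] := refl_aut ra; split.
  apply: contraNneq (root_neq0 rb) => e.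
  have := congr1 (fun c => ev c (Hc a)) e; rewrite evB evZ ev0 ev_Hc // => e2.
  have e0 : ev b (Hc a) = 0 by lra.
  by rewrite -e e0 scale0r subr0.
exists (f (X b)); split.
  have [g gk _] := bf; apply: contraNneq (X_neq0 rb) => e.
  by rewrite -(gk (X b)) -(gk 0) e linear0.
move=> H hH; set H' := H - ev a H *: Hc a.
have hH' : H' \in h by rewrite rpredB // rpredZ // Hc_h.
have {1}-> : H = f H'.
  rewrite fh // /H' evBr evZr ev_Hc // (_ : ev a H - ev a H * 2 = - ev a H); last by ring.
  by rewrite scaleNr opprK subrK.
rewrite -fm (rspX rb) // linearZ /=; congr (_ *: _).
by rewrite /H' evBr evZr evB evZ mulrC.
Qed.

(** Integrality of [a] on the coroot of [3 *: a] rules out that root, so [X_a, X_{2a}] = 0; and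
    [X_{-a}, X_{2a}] is a multiple of X_a. The Jacobi identity then makes [H_a, X_{2a}] = 4 X_{2a}
    vanish. *)
Lemma root_double a : root a -> ~ root (2 *: a).
Proof.
move=> ra r2.
have n3 : ~ root (3 *: a).
  move=> r3; have := ev_Hc r3; have [z ez] := ev_Hc_int ra r3.
  rewrite evZ ez -[3]/(3%:~R) -[2]/(2%:~R) -rmorphM => /intr_inj; lia.
have w3 : rsp (3 *: a) (br (X a) (X (2 *: a))).
  have := rsp_br (rspX ra) (rspX r2); rewrite -[a in a + _]scale1r -scalerDl.
  by rewrite (_ : 1 + 2 = 3 :> R) //; ring.
have z3 : br (X a) (X (2 *: a)) = 0.
  apply: rsp_eq0 w3; last exact/rootsP.
  by rewrite scaler_eq0 pnatr_eq0 root_neq0.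
have w1 : rsp a (br (X (- a)) (X (2 *: a))).
  have := rsp_br (rspX (rootN ra)) (rspX r2); congr (rsp _ _).
  by rewrite scaler_nat mulr2n addrA addNr add0r.
have /vlineP[c ec] := rsp_line ra w1.
have := jacobi lieL (X a) (X (- a)) (X (2 *: a)).
rewrite z3 ec (brZr lieL) (brxx lieL) scaler0 (br0r lieL) addr0 br_XX // (brNl lieL).
rewrite (rspX r2) ?Hc_h // evZ ev_Hc // => /esym/eqP.
rewrite oppr_eq0 scaler_eq0 (negPf (X_neq0 r2)) orbF mulf_eq0 pnatr_eq0 //.
Qed.

(** * The Killing form on the Cartan subalgebra *)

Import passmx.

Lemma weight_basis : exists2 e : (\dim {:L}).-tuple L, basis_of {:L} e &
  forall x, x \in e -> exists b : functional h, rsp b x.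
Proof.
apply: basis_of_spanning => U hU; apply: roots_span => [|a ra].
  by apply/subvP => H /rsp_h hH; apply: hU; exists 0.
by apply: hU; exists a; apply/rspX/roots_root.
Qed.

Local Notation Mx := (mxof (vbasis {:L}) (vbasis {:L})).

(** The Killing form is defined in [vbasis]; this allows its computation in a basis of weight
    vectors. *)
Lemma tr_basis (e : (\dim {:L}).-tuple L) (f : 'End(L)) : basis_of {:L} e ->
  \tr (Mx f) = \tr (mxof e e f).
Proof.
move=> be; have bv := vbasisP {:L}.
have e1 : Mx f = mxof (vbasis {:L}) e \1%VF *m mxof e (vbasis {:L}) f.
  by rewrite -(mxof_comp _ _ be) comp_lfun1r.
have e2 : mxof e (vbasis {:L}) f = mxof e e f *m mxof e (vbasis {:L}) \1%VF.
  by rewrite -(mxof_comp _ _ be) comp_lfun1l.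
rewrite e1 e2 mulmxA mxtrace_mulC mulmxA -(mxof_comp _ _ bv) comp_lfun1l.
by rewrite mxof1 ?(basis_free be) // mul1mx.
Qed.

Lemma killingE x y : killing br x y = \tr (Mx (ad br y) *m Mx (ad br x)).
Proof. by rewrite /killing (mxof_comp _ _ (vbasisP _)). Qed.
Lemma killingC x y : killing br x y = killing br y x.
Proof. by rewrite !killingE mxtrace_mulC. Qed.
Lemma killing_linear c x y z : killing br (c *: x + y) z = c * killing br x z + killing br y z.
Proof.
have -> : killing br (c *: x + y) z = \tr (Mx (c *: (ad br x \o ad br z) + (ad br y \o ad br z))%VF).
  rewrite /killing; congr (\tr (Mx _)); apply/lfunP => t.
  by rewrite add_lfunE scale_lfunE !comp_lfunE !(adE lieL) (brDl lieL) (brZl lieL).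
by rewrite linearP /= mxtraceD mxtraceZ.
Qed.
Lemma killing0l x : killing br 0 x = 0.
Proof. by have := killing_linear 1 0 0 x; rewrite scaler0 addr0; lra. Qed.
Lemma killingZl c x y : killing br (c *: x) y = c * killing br x y.
Proof. by rewrite -[c *: x]addr0 killing_linear killing0l addr0. Qed.
Lemma killing_inv x y z : killing br (br x y) z = killing br x (br y z).
Proof.
have E u v : Mx (ad br (br u v)) = Mx (ad br v) *m Mx (ad br u) - Mx (ad br u) *m Mx (ad br v).
  rewrite -!(mxof_comp _ _ (vbasisP _)) -linearB; congr (Mx _); apply/lfunP => t.
  rewrite add_lfunE opp_lfunE !comp_lfunE !(adE lieL) ((jacobi lieL) u v).
  by rewrite addrK.
rewrite !killingE !E; move: (Mx (ad br x)) (Mx (ad br y)) (Mx (ad br z)) => A C D.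
rewrite mulmxBr mulmxBl !raddfB /= !mulmxA; congr (_ - _).
by rewrite mxtrace_mulC mulmxA.
Qed.

(** In a basis of weight vectors the trace is the sum of the squares of the real weights at [H]. *)
Lemma killing_hh H : H \in h -> 0 <= killing br H H /\
  (killing br H H = 0 -> forall a, root a -> ev a H = 0).
Proof.
move=> hH; have [e be we] := weight_basis.
have eig (i : 'I_(\dim {:L})) : exists b : functional h, br H e`_i = ev b H *: e`_i.
  have [|b hb] := we e`_i; first by rewrite mem_nth ?size_tuple.
  by exists b; apply: hb.
have [w hw] := fin_all_exists eig.
have K : killing br H H = \sum_i ev (w i) H ^+ 2.
  rewrite /killing (tr_basis _ be); apply: eq_bigr => i _.
  rewrite !mxE /= vecof_delta comp_lfunE !(adE lieL) !hw (brZr lieL) hw.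
  by rewrite scalerA linearZ /= coord_free ?(basis_free be) // eqxx mulr1 expr2.
split; first by rewrite K sumr_ge0 // => i _; rewrite sqr_ge0.
rewrite K => /eqP; rewrite psumr_eq0 => [|i _]; last by rewrite sqr_ge0.
move=> /allP wz a ra.
have z x : br H x = 0.
  rewrite (coord_basis be (memvf x)) (br_sumr lieL) big1 // => i _.
  have := wz i (mem_index_enum i); rewrite /= sqrf_eq0 => /eqP e0.
  by rewrite (brZr lieL) hw e0 scale0r scaler0.
have := z (X a); rewrite (rspX ra) // => /eqP; rewrite scaler_eq0 (negPf (X_neq0 ra)) orbF.
by move/eqP.
Qed.

(** Such an [H] commutes with [h] and with every [X a], so its line is an abelian ideal. *)
Lemma h_center H : H \in h -> (forall a, root a -> ev a H = 0) -> H = 0.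
Proof.
move=> hH z.
have c x : br H x = 0.
  have : x \in lker (ad br H).
    rewrite (@roots_span (lker _)) ?memvf //.
      by apply/subvP => H' hH'; rewrite memv_ker (adE lieL) br_hh.
    by move=> a /roots_root ra; rewrite memv_ker (adE lieL) (rspX ra) // z // scale0r.
  by rewrite memv_ker (adE lieL) => /eqP.
have : <[H]>%VS = 0%VS.
  apply: ssL.
    by move=> x y /vlineP[k ->]; rewrite (brZr lieL) (br_anti lieL) c oppr0 scaler0 mem0v.
  exists 1%N; apply/eqP; rewrite -subv0 /=; apply/span_subvP => x.
  case/allpairsP => -[u v] /= [/vbasis_mem/vlineP[k ->] _ ->].
  by rewrite (brZl lieL) c scaler0 mem0v.
by move/eqP; rewrite -subv0 -memvE memv0 => /eqP.
Qed.

Lemma killing_gt0 H : H \in h -> H != 0 -> 0 < killing br H H.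
Proof.
move=> hH n0; have [p z] := killing_hh hH; rewrite lt0r p andbT.
by apply: contra n0 => /eqP/z/(h_center hH)->.
Qed.

Lemma gram_unit : gram br h \in unitmx.
Proof.
rewrite unitmxE unitfE; apply/det0P => -[v v0 vG].
pose x := \sum_i v 0 i *: tnth (vbasis h) i.
have hx : x \in h by rewrite rpred_sum // => i _; rewrite rpredZ // vbasis_mem ?mem_tnth.
have K y : killing br x y = \sum_i v 0 i * killing br (tnth (vbasis h) i) y.
  rewrite /x; apply: (big_rec2 (fun a b => killing br a y = b)).
    by rewrite killing0l.
  by move=> i a b _ <-; rewrite killing_linear.
have Kj j : killing br x (tnth (vbasis h) j) = 0.
  have := congr1 (fun M : 'rV_(\dim h) => M 0 j) vG; rewrite !mxE => e.
  by rewrite K -[RHS]e; apply: eq_bigr => i _; rewrite mxE.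
have x0 : x = 0.
  apply/eqP; apply: contraT => n; have := killing_gt0 hx n.
  rewrite K big1 ?ltxx // => i _; rewrite killingC Kj mulr0 //.
case/eqP: v0; apply/rowP => i; rewrite mxE.
have /freeP fr := basis_free (vbasisP h); apply: (fr (v 0)).
by rewrite -[RHS]x0; apply: eq_bigr => k _; rewrite (tnth_nth 0).
Qed.

(* the element of [h] representing the functional through the Killing form *)
Definition dualh (a : functional h) : L :=
  \sum_i (invmx (gram br h) *m (coords a)^T) i 0 *: tnth (vbasis h) i.

Lemma dualh_h a : dualh a \in h.
Proof. by rewrite rpred_sum // => i _; rewrite rpredZ // vbasis_mem ?mem_tnth. Qed.

Lemma ev_dualh a b : ev a (dualh b) = inner br a b.
Proof.
rewrite /inner -mulmxA /dualh ev_sumr mxE; apply: eq_bigr => i _.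
by rewrite evZr [in RHS]mxE mulrC.
Qed.

Lemma killing_sumr I (s : seq I) (F : I -> R) (G : I -> L) x :
  killing br x (\sum_(i <- s) F i *: G i) = \sum_(i <- s) F i * killing br x (G i).
Proof.
rewrite killingC; apply: (big_rec2 (fun a b => killing br a x = b)).
  by rewrite killing0l.
by move=> i a b _ <-; rewrite killing_linear (killingC x).
Qed.

Lemma killing_dualh a H : H \in h -> killing br H (dualh a) = ev a H.
Proof.
move=> hH; have base j : killing br (tnth (vbasis h) j) (dualh a) = ev a (tnth (vbasis h) j).
  have : gram br h *m (invmx (gram br h) *m (coords a)^T) = (coords a)^T.
    by rewrite mulKVmx ?gram_unit.
  move/(congr1 (fun M : 'cV_(\dim h) => M j 0)); rewrite mxE [RHS]mxE [RHS]mxE => <-.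
  by rewrite killing_sumr; apply: eq_bigr => i _; rewrite [gram _ _ _ _]mxE mulrC.
rewrite (coord_vbasis hH) killingC killing_sumr ev_sumr; apply: eq_bigr => i _.
by rewrite evZr killingC -(tnth_nth 0) base.
Qed.

Lemma innerC (a b : functional h) : inner br a b = inner br b a :> R.
Proof.
by rewrite -ev_dualh -(killing_dualh _ (dualh_h b)) killingC killing_dualh ?dualh_h // ev_dualh.
Qed.
Lemma inner_linear (c : R) (a b d : functional h) :
  inner br (c *: a + b) d = c * inner br a d + inner br b d.
Proof. by rewrite -!ev_dualh evD evZ. Qed.
Lemma inner_gt0 (a : functional h) : a != 0 -> 0 < inner br a a.
Proof.
move=> a0; rewrite -ev_dualh -killing_dualh ?dualh_h // killing_gt0 ?dualh_h //.
apply: contra a0 => /eqP e; apply/eqP/ev_inj => H hH.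
by rewrite -killing_dualh // e ev0 killingC killing0l.
Qed.

(** This links the reflections of the inner product with the coroots. Invariance of the Killing form
    makes [Hc a] a multiple of [dualh a], and [ev a (Hc a) = 2] fixes the multiple. *)
Lemma cn_inner (l a : functional h) : root a -> 2 * inner br l a / inner br a a = ev l (Hc a).
Proof.
move=> ra; pose c := - killing br (X a) (X (- a)).
have KH H : H \in h -> killing br H (Hc a) = c * ev a H.
  move=> hH; rewrite -[Hc a]opprK -br_XX // killingC -scaleN1r killingZl.
  by rewrite killingC -killing_inv (rspX ra) // killingZl /c; ring.
have e : Hc a = c *: dualh a.
  apply/eqP; rewrite -subr_eq0; apply: contraT => n.
  set d := Hc a - c *: dualh a in n.
  have hd : d \in h by rewrite rpredB ?rpredZ ?dualh_h ?Hc_h.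
  have : killing br d d = 0.
    rewrite {1}/d addrC -scaleNr killing_linear !(killingC _ d) KH // killing_dualh //.
    by ring.
  by move=> e0; have := killing_gt0 hd n; rewrite e0 ltxx.
have e2 := ev_Hc ra; move: e2; rewrite e !evZr !ev_dualh => e2.
have p := inner_gt0 (root_neq0 ra).
by rewrite -e2; field; rewrite gt_eqF.
Qed.

Lemma cnE_ev (l a : functional h) : root a -> cn (inner br (h := h)) l a = ev l (Hc a).
Proof. exact: cn_inner. Qed.

Lemma actE (w : seq (functional h)) (l : functional h) :
  foldr (fun a f => refl br a \o f) id w l = act (inner br (h := h)) w l.
Proof. by elim: w => //= a w ->. Qed.

Lemma roots_rfl (a b : functional h) : a \in roots -> b \in roots ->
  rfl (inner br (h := h)) a b \in roots.
Proof.
move=> /rootsP ra /rootsP rb; apply/rootsP; rewrite /rfl cnE_ev //.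
exact: root_rfl.
Qed.
Lemma roots_int (a b : functional h) : a \in roots -> b \in roots ->
  exists z : int, cn (inner br (h := h)) a b = z%:~R.
Proof. by move=> /rootsP ra /rootsP rb; rewrite cnE_ev //; apply: ev_Hc_int. Qed.
Lemma roots_red (a : functional h) : a \in roots -> 2 *: a \notin roots.
Proof. by move=> /rootsP ra; apply/rootsP; apply: root_double. Qed.
Lemma roots_neq0 : (0 : functional h) \notin roots.
Proof. by apply/rootsP => -[]; rewrite eqxx. Qed.

(** * Cayley transforms in strongly orthogonal roots *)

Lemma br_X0 (a b : functional h) : root a -> root b ->
  a + b != 0 -> a + b \notin roots -> br (X a) (X b) = 0.
Proof. by move=> ra rb n0 nr; apply: rsp_eq0 n0 nr (rsp_br (rspX ra) (rspX rb)). Qed.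

(* In the SL_2 of the root a this is the conjugation taking diag(1,-1)/2 to
   the symmetric matrix with entries 1/2 off the diagonal. *)
Lemma cayley a : root a -> exists2 f : 'End(L), automorphism br f &
  (forall H, H \in h -> f H = H - (ev a H / 2) *: Hc a + (ev a H / 2) *: (X a - X (- a))) /\
  forall y, br (X a) y = 0 -> br (X (- a)) y = 0 -> f y = y.
Proof.
move=> ra; have rn := rootN ra.
(* With [c = ev a H], the parameter -1/2 produces [c / 2] times [X a]. The parameter -1 in the
   second factor then removes [c / 2] times [Hc a] and leaves the coefficient [- c / 2] at
   [X (- a)]. *)
have [f af [fh f0 _]] := expX (- 2^-1) ra.
have [g ag [gh g0 gX]] := expX (-1) rn.
exists (g \o f)%VF; first exact: aut_comp.
split=> [H hH|y y1 y2]; last by rewrite comp_lfunE f0 // g0.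
rewrite comp_lfunE (fh _ hH) [g _]linearB /= [g (_ *: _)]linearZ /= (gh _ hH).
move: gX; rewrite opprK Hc_opp // => ->.
rewrite evN -signr_odd /= expr0 scale1r scaleN1r !opprK mulN1r opprK.
set c := ev a H; rewrite !scalerDr !scalerN.
have e x : (- 2^-1 * c) *: x = - ((c / 2) *: x) by rewrite mulNr mulrC scaleNr.
rewrite !e !opprD !opprK.
have -> : c *: X (- a) = (c / 2) *: X (- a) + (c / 2) *: X (- a).
  by rewrite -scalerDl; congr (_ *: _); lra.
rewrite opprD !addrA.
rewrite [LHS](AC 6 (1*5*4*2*(3*6))) /= addNr addr0.
by [].
Qed.

Section StronglyOrthogonal.
Variable G : seq (functional h).
Hypothesis uG : uniq G.
Hypothesis rG : {subset G <= roots}.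
Hypothesis sG : strongly_orth (inner br (h := h)) roots G.

Lemma G_root g : g \in G -> root g.
Proof. by move=> /rG/rootsP. Qed.

Lemma G_ev g g' : g \in G -> g' \in G -> g != g' -> ev g (Hc g') = 0.
Proof.
move=> hg hg' n; have [o _ _] := sG hg hg' n.
by rewrite -(cn_inner g (G_root hg')) o mulr0 mul0r.
Qed.

(** Here strong orthogonality enters the Lie algebra: sums of the roots [g] and [g'], with any
    signs, are neither zero nor roots. *)
Lemma G_comm g g' : g \in G -> g' \in G -> g != g' ->
  br (X g) (X g') = 0 /\ br (X (- g)) (X g') = 0 /\
  br (X g) (X (- g')) = 0 /\ br (X (- g)) (X (- g')) = 0.
Proof.
move=> hg hg' n; have [o np nm] := sG hg hg' n.
have [r r'] := (G_root hg, G_root hg').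
have ev2 := ev_Hc r'; have ev0' := G_ev hg hg' n.
have p0 : g + g' != 0.
  apply/negP; rewrite addrC addr_eq0 => /eqP e; move: ev2; rewrite {1}e evN ev0' oppr0.
  by move/esym/eqP; rewrite pnatr_eq0.
have m0 : g - g' != 0 by rewrite subr_eq0.
have neg a : a \notin roots -> - a \notin roots.
  by move=> na; apply: contra na => /rootsP/rootN; rewrite opprK => /rootsP.
split; first exact: br_X0.
split; first by apply: br_X0 => //; [exact: rootN|rewrite addrC -opprB oppr_eq0|rewrite addrC -opprB neg].
split; first by apply: br_X0 => //; exact: rootN.
by apply: br_X0; rewrite -?opprD ?oppr_eq0 ?neg //; apply: rootN.
Qed.

Definition proj0 (H : L) := H - \sum_(g <- G) (ev g H / 2) *: Hc g.

Lemma proj0_h H : H \in h -> proj0 H \in h.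
Proof.
move=> hH; rewrite rpredB // big_seq rpred_sum // => g hg.
by apply/rpredZ/Hc_h/G_root.
Qed.

Lemma ev_proj0 g H : g \in G -> ev g (proj0 H) = 0.
Proof.
move=> hg; rewrite evBr ev_sumr (bigD1_seq g) //= big_seq_cond big1 => [|g' /andP[hg' n]].
  by rewrite evZr (ev_Hc (G_root hg)) addr0; lra.
by rewrite evZr G_ev ?mulr0 // eq_sym.
Qed.

(** The image of [H] under the product of the Cayley transforms: each component along a coroot
    [Hc g] is turned into a multiple of [X g - X (- g)]. *)
Definition Eof (H : L) := proj0 H + \sum_(g <- G) (ev g H / 2) *: (X g - X (- g)).

End StronglyOrthogonal.

(** The transform of a new root [a] fixes the terms [X g - X (- g)] already present, which commute
    with [X a] and [X (- a)]; it acts on [proj0 G H], where [a] takes the same value as on [H] by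
    orthogonality. *)
Lemma Eof_aut G : uniq G -> {subset G <= roots} ->
  strongly_orth (inner br (h := h)) roots G ->
  exists2 f : 'End(L), automorphism br f & forall H, H \in h -> f H = Eof G H.
Proof.
elim: G => [|a G IH] /=.
  move=> _ _ _; exists \1%VF; first exact: aut_id.
  by move=> H _; rewrite id_lfunE /Eof /proj0 !big_nil subr0 addr0.
move=> /andP[aG uG] rG sG.
have uaG : uniq (a :: G) by rewrite /= aG.
have inG g : g \in G -> g \in a :: G by rewrite in_cons => ->; rewrite orbT.
have [//|g /inG/rG//|g g' /inG hg /inG hg'|f af fE] := IH; first exact: sG.
have aa := mem_head a G; have ra := G_root rG aa.
have [k ak [kh k0]] := cayley ra.
exists (k \o f)%VF; first exact: aut_comp.
move=> H hH; rewrite comp_lfunE fE // /Eof linearD /= kh; last first.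
  by apply: proj0_h => // g /inG/rG.
have -> : ev a (proj0 G H) = ev a H.
  rewrite /proj0 evBr ev_sumr big_seq big1 ?subr0 // => g hg.
  have n : a != g by apply: contraNneq aG => ->.
  by rewrite evZr (G_ev rG sG aa (inG _ hg) n) mulr0.
rewrite linear_sum /= big_cons /proj0 big_cons opprD addrA.
rewrite (_ : \sum_(g <- G) k _ = \sum_(g <- G) (ev g H / 2) *: (X g - X (- g))); last first.
  rewrite !big_seq; apply: eq_bigr => g hg.
  have n : a != g by apply: contraNneq aG => ->.
  have [c1 [c2 [c3 c4]]] := G_comm rG sG aa (inG _ hg) n.
  by rewrite k0 // (brZr lieL) (brBr lieL) ?c1 ?c2 ?c3 ?c4 subrr scaler0.
by congr (_ + _ + _); rewrite [RHS]addrA addrAC.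
Qed.

(** * The involution attached to an odd coweight *)

Section Sigma.
Variable G : seq (functional h).
Hypothesis uG : uniq G.
Hypothesis rG : {subset G <= roots}.
Hypothesis sG : strongly_orth (inner br (h := h)) roots G.
Variable lam : L.
Hypothesis lam_h : lam \in h.
Hypothesis lam_int : forall a, a \in roots -> exists z : int, ev a lam = z%:~R.
Hypothesis lam_odd : forall g, g \in G -> exists z : int, ev g lam = (z * 2 + 1)%:~R.

Lemma intdiag_Eof : intdiag br (Eof G lam).
Proof.
have [f af <-//] := Eof_aut uG rG sG; apply: intdiag_aut => // U hU.
apply: roots_span => [|a ra].
  apply/subvP => H hH; apply: hU; exists 0; rewrite /eigz scale0r; exact: br_hh.
have [z hz] := lam_int ra; apply: hU; exists z.
by rewrite /eigz -hz; apply: (rspX (roots_root ra)).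
Qed.

Lemma tau_Eof : tau (Eof G lam) = - Eof G lam.
Proof.
rewrite /Eof [LHS]linearD /= (tau_h (proj0_h rG lam_h)) [RHS]opprD.
congr (_ + _).
rewrite -sumrN [LHS]linear_sum /=.
rewrite !big_seq; apply: eq_bigr => g hg; have rg := G_root rG hg.
by rewrite /= linearZ linearB /= !tau_X // ?opprK -?scalerN ?opprB //; apply: rootN.
Qed.

Lemma Eof_br_h H : H \in h -> (forall g, g \in G -> ev g H = 0) -> eigz br (Eof G lam) H 0.
Proof.
move=> hH z; rewrite /eigz scale0r /Eof (brDl lieL) br_hh ?proj0_h // add0r.
rewrite (br_suml lieL) big_seq big1 // => g hg; have rg := G_root rG hg.
rewrite (brZl lieL) (brBl lieL) !br_Xh //; last exact: rootN.
by rewrite evN z // oppr0 !scale0r subrr scaler0.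
Qed.

(** In the sl_2 of [g], this vector is an eigenvector of [X g - X (- g)] with eigenvalue [- 2 * e];
    the other summands of [Eof G lam] commute with it. *)
Lemma Eof_eig g (e : R) z : g \in G -> ev g lam = z%:~R -> e ^+ 2 = 1 ->
  br (Eof G lam) (Hc g + e *: (X g + X (- g))) =
    (- e * z%:~R) *: (Hc g + e *: (X g + X (- g))).
Proof.
move=> hg ez e1; have rg := G_root rG hg; have rn := rootN rg.
set y := _ + e *: _.
have p0 : br (proj0 G lam) y = 0.
  have hp := proj0_h rG lam_h; have e0 := ev_proj0 uG rG sG lam hg.
  rewrite /y (brDr lieL) br_hh ?Hc_h // (brZr lieL) (brDr lieL) (rspX rg) // (rspX rn) //.
  by rewrite evN e0 oppr0 !scale0r add0r addr0 scaler0.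
have s0 g' : g' \in G -> g' != g -> br (X g' - X (- g')) y = 0.
  move=> hg' n; have [c1 [c2 [c3 c4]]] := G_comm rG sG hg' hg n.
  have rg' := G_root rG hg'; have rn' := rootN rg'.
  rewrite /y (brDr lieL) (brZr lieL) (brDr lieL) !(brBl lieL) c1 c2 c3 c4 !br_Xh ?Hc_h //.
  by rewrite evN (G_ev rG sG) // oppr0 !scale0r !subrr addr0 scaler0 addr0.
have main : br (X g - X (- g)) y = (- 2 * e) *: y.
  have b1 : br (X g) (Hc g) = - (2 *: X g) by rewrite br_Xh ?Hc_h // ev_Hc.
  have b2 : br (X (- g)) (Hc g) = 2 *: X (- g).
    by rewrite br_Xh ?Hc_h // evN ev_Hc // scaleNr opprK.
  have b3 := br_XX rg.
  have b4 : br (X (- g)) (X g) = Hc g by rewrite (br_anti lieL) b3 opprK.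
  rewrite /y (brDr lieL) (brZr lieL) (brDr lieL) !(brBl lieL) b1 b2 b3 b4 !(brxx lieL).
  have -> : - (2 *: X g) - 2 *: X (- g) = (- 2) *: (X g + X (- g)).
    by rewrite scalerDr !scaleNr.
  have -> : e *: (0 - Hc g + (- Hc g - 0)) = (- 2 * e) *: Hc g.
    by rewrite sub0r subr0 -opprD -mulr2n -scaler_nat scalerN scalerA mulNr scaleNr mulrC.
  by rewrite [RHS]scalerDr scalerA -[_ * e * e]mulrA -expr2 e1 mulr1 addrC.
rewrite /Eof (brDl lieL) p0 add0r (br_suml lieL) (bigD1_seq g) //= big_seq_cond big1; last first.
  by move=> g' /andP[hg' n]; rewrite (brZl lieL) s0 // scaler0.
by rewrite addr0 (brZl lieL) main scalerA ez; congr (_ *: _); lra.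
Qed.

Lemma sigma_exists : exists sigma : 'End(L),
  [/\ automorphism br sigma, forall x, sigma (sigma x) = x, iso_to_split br sigma,
      forall x, sigma (tau x) = tau (sigma x) &
      forall H, H \in h -> sigma H = H - \sum_(g <- G) ev g H *: Hc g].
Proof.
have dE := intdiag_Eof.
have [sg [asg inv iso sgE]] := grading_involution lieL dE.
exists sg; split=> //.
  (* [tau] negates [Eof G lam], so it exchanges the eigenvalues [m] and [- m], which have the same
     parity. *)
  suff e : (sg \o tau = tau \o sg)%VF by move=> x; rewrite -!comp_lfunE e.
  apply: (eig_ext dE) => x m hx; rewrite !comp_lfunE (sgE _ _ hx) linearZ /=.
  have hx' : eigz br (Eof G lam) (tau x) (- m).
    have := congr1 tau hx; rewrite tau_br tau_Eof (brNl lieL) linearZ /= => /eqP.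
    by rewrite eqr_oppLR => /eqP e; rewrite /eigz e mulrNz scaleNr.
  rewrite (sgE _ _ hx'); congr (_ *: _); rewrite /sgz2.
  by rewrite (_ : ((- m) %% 2)%Z = (m %% 2)%Z) //; lia.
have sgHc g : g \in G -> sg (Hc g) = - Hc g.
  move=> hg; have [z hz] := lam_odd hg.
  pose u (e : R) := Hc g + e *: (X g + X (- g)).
  have su (e : int) : (e = 1 \/ e = -1) -> sg (u e%:~R) = - u e%:~R.
    move=> e1; have ee : (e%:~R : R) ^+ 2 = 1 by case: e1 => ->; ring.
    have hu : eigz br (Eof G lam) (u e%:~R) (- e * (z * 2 + 1)).
      by rewrite /eigz (Eof_eig hg hz ee) rmorphM rmorphN.
    rewrite (sgE _ _ hu) /sgz2 (_ : _ == 0 = false) ?scaleN1r //.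
    by case: e1 => ->; lia.
  (* The coroot is the half-sum of the eigenvectors for [e = 1] and [e = -1], whose eigenvalues are
     odd. *)
  have -> : Hc g = 2^-1 *: (u 1%:~R + u (-1)%:~R).
    rewrite /u addrACA -scalerDl (_ : 1%:~R + (-1)%:~R = 0 :> R); last by ring.
    by rewrite scale0r addr0 -mulr2n -scaler_nat scalerA mulVf ?scale1r // pnatr_eq0.
  rewrite linearZ linearD /= !su; [|by right|by left].
  by rewrite -opprD scalerN.
move=> H hH; have hp := proj0_h rG hH.
have s0 : sg (proj0 G H) = proj0 G H.
  rewrite (sgE _ 0) ?/sgz2 ?scale1r //; apply: Eof_br_h => // g hg.
  exact: ev_proj0.
have eH : H = proj0 G H + \sum_(g <- G) (ev g H / 2) *: Hc g by rewrite subrK.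
rewrite {1}eH linearD /= s0 linear_sum /=.
rewrite (_ : \sum_(g <- G) sg _ = - \sum_(g <- G) (ev g H / 2) *: Hc g); last first.
  rewrite -sumrN !big_seq; apply: eq_bigr => g hg.
  by rewrite linearZ /= sgHc // scalerN.
rewrite /proj0 -addrA -opprD -big_split /=; congr (_ - _); apply: eq_bigr => g _.
by rewrite -scalerDl; congr (_ *: _); lra.
Qed.

End Sigma.

(** The coweight is turned into an element of [h] by [dualh]. As [sg] is its own inverse, its
    formula on [h] is the transpose of that of [s] in terms of [G]; stability of the compact form
    comes from commutation with [tau]. *)
Lemma weyl_involution_lift (s : 'End(functional h)) : in_I br s -> in_weyl br s ->
  exists sigma : 'End(L), inv_tau br h tau sigma /\ rho_eq sigma s /\ iso_to_split br sigma.
Proof.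
move=> [ss _ _] [w [rw sw]].
have sE l : s l = act (inner br (h := h)) w l by rewrite sw actE.
have ws : {subset w <= roots} by move=> a /rw/rootsP.
have inv : involutive (act (inner br (h := h)) w) by move=> l; rewrite -!sE ss.
have [G [uG rG sG nG eG]] := involution_decomp innerC inner_linear inner_gt0
  roots_neq0 roots_rfl roots_int roots_red ws inv.
have [y [yint yodd]] := odd_coweight innerC inner_linear inner_gt0
  roots_neq0 roots_rfl roots_int roots_red ws inv uG rG sG nG eG.
have [||sg [asg invs iso ct sh]] := sigma_exists uG rG sG (dualh_h y).
- by move=> a /yint[z hz]; exists z; rewrite ev_dualh.
- by move=> g /yodd[z hz]; exists z; rewrite ev_dualh.
have shh H : H \in h -> sg H \in h.
  move=> hH; rewrite sh // rpredB // big_seq rpred_sum // => g hg.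
  by apply/rpredZ/Hc_h/(G_root rG).
exists sg; split; last split=> //.
- split=> //.
    apply/eqP; rewrite eqEsubv; apply/andP; split; apply/subvP => H.
      by case/memv_imgP => H' hH' ->; apply: shh.
    by move=> hH; rewrite -(invs H) memv_img // shh.
  move=> [q1 q2]; split=> [[/= h1 h2]|[[p1 p2] [[/= h1 h2] [<- <-]]]].
    exists (extC sg (q1, q2)); split; rewrite /real_form /extC /= ?invs.
      by rewrite -ct h1 linearN /= -ct h2 linearN /= opprK.
    by rewrite linearN /= invs opprK.
  by rewrite /real_form /= -ct h1 linearN /= -ct h2 linearN.
- move=> a H hH.
  have -> : (sg^-1)%VF H = sg H.
    rewrite -{1}(invs H) lker0_lfunK //; apply/lker0P => u v e.
    by rewrite -(invs u) e invs.
  rewrite sE eG evB ev_suml sh // evBr ev_sumr; congr (_ - _).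
  rewrite !big_seq; apply: eq_bigr => g hg.
  by rewrite evZ evZr (cnE_ev _ (G_root rG hg)) mulrC.
Qed.

End Chevalley.

Theorem theorem3p13 (R : realType) (L : vectType R) (br : L -> L -> L)
    (h : {vspace L}) (X Hc : functional h -> L) (tau : 'End(L))
    (s : 'End(functional h)) :
  lie_algebra br -> semisimple br -> cartan br h ->
  chevalley br X Hc tau ->
  in_I br s -> in_weyl br s ->
  exists sigma : 'End(L),
    inv_tau br h tau sigma /\ rho_eq sigma s /\ iso_to_split br sigma.
Proof.
by move=> lieL ssL cartanh chev; apply: (weyl_involution_lift lieL ssL cartanh chev).
Qed.
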